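(* Let $\ell\in\mathbb N$ and, for $1\le k\le\ell$, let $\mathbf X_k=(X_{k,1},\ldots,X_{k,n_k})$ and $\mathbf Y_k=(Y_{k,1},\ldots,Y_{k,m_k})$ be tuples of self-adjoint operators ($n_k,m_k\ge0$, $n_k+m_k\ge1$) in a C$^*$-non-commutative probability space $(\mathcal A,\varphi)$ such that all the $X_{k,i}$ (left variables) and all the $Y_{k,j}$ (right variables) together form a tracially bi-partite system. Write $\mathbf Z_k=\mathbf X_k\sqcup\mathbf Y_k$. Then \[ \chi(\mathbf X_1,\ldots,\mathbf X_\ell\sqcup\mathbf Y_1,\ldots,\mathbf Y_\ell)\le\chi_{\mathrm{orb}}(\mathbf Z_1,\ldots,\mathbf Z_\ell)+\sum_{k=1}^\ell\chi(\mathbf Z_k), \] where $\chi$ is the microstate bi-free entropy and $\chi_{\mathrm{orb}}$ the orbital bi-free entropy.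
   Context: A C$^*$-non-commutative probability space $(\mathcal A,\varphi)$ is a unital C$^*$-algebra with a state $\varphi$. A tracially bi-partite system $(\{X_i\}_{i=1}^n,\{Y_j\}_{j=1}^m)$ in $(\mathcal A,\varphi)$ consists of self-adjoint operators $X_1,\ldots,X_n$ (left variables) and $Y_1,\ldots,Y_m$ (right variables) in $\mathcal A$ such that every $X_i$ commutes with every $Y_j$ (in distribution: interchanging adjacent $X_i,Y_j$ in a word does not change $\varphi$ of the word) and $\varphi$ is tracial on the unital algebra generated by the $X_i$ and on the unital algebra generated by the $Y_j$; $\varphi$ is not assumed tracial or faithful on $\mathcal A$. Microstate bi-free entropy. $\mathcal M_d$ is the algebra of complex $d\times d$ matrices, $\mathcal M_d^{sa}$ its self-adjoint part, $\mathrm{Tr}_d$ the trace, $\tau_d=\frac1d\mathrm{Tr}_d$, $\|\cdot\|$ the operator norm, and $\lambda_{d,p}$ is Lebesgue measure on $(\mathcal M_d^{sa})^p$ normalized by the inner product $\langle (A_i),(B_i)\rangle=\sum_i\mathrm{Tr}_d(A_iB_i)$. For $M,d\in\mathbb N$ and $R,\epsilon>0$, $\Gamma_R(X_1,\ldots,X_n\sqcup Y_1,\ldots,Y_m;M,d,\epsilon)$ is the set of $(A_1,\ldots,A_n,B_1,\ldots,B_m)\in(\mathcal M_d^{sa})^{n+m}$ with $\|A_i\|,\|B_j\|\le R$ for all $i,j$ and \[ |\varphi(X_{i_1}\cdots X_{i_p}Y_{j_1}\cdots Y_{j_q})-\tau_d(A_{i_1}\cdots A_{i_p}B_{j_q}\cdots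 B_{j_1})|<\epsilon \] for all $p,q\ge0$ with $1\le p+q\le M$ and all indices. Define (with $\log 0=-\infty$) $\chi_R(\cdot;M,d,\epsilon)=\log\lambda_{d,n+m}(\Gamma_R(\cdot;M,d,\epsilon))$, $\chi_R(\cdot;M,\epsilon)=\limsup_{d\to\infty}\big(\frac1{d^2}\chi_R(\cdot;M,d,\epsilon)+\frac{n+m}2\log d\big)$, $\chi_R(\cdot)=\inf_{M\in\mathbb N,\epsilon>0}\chi_R(\cdot;M,\epsilon)$, and $\chi(X_1,\ldots,X_n\sqcup Y_1,\ldots,Y_m)=\sup_{R>0}\chi_R(X_1,\ldots,X_n\sqcup Y_1,\ldots,Y_m)\in[-\infty,\infty)$. For the joint family, the left variables are those in $\mathbf X_1,\ldots,\mathbf X_\ell$ and the right variables those in $\mathbf Y_1,\ldots,\mathbf Y_\ell$, in the order listed; $\chi(\mathbf Z_k)=\chi(\mathbf X_k\sqcup\mathbf Y_k)$. Orbital bi-free entropy. Let $U(d)$ be the unitary group of $\mathcal M_d$ with normalized Haar measure $\gamma_d$, and $E_d=\prod_{k=1}^\ell(\mathcal M_d^{sa})^{n_k}\times\prod_{k=1}^\ell(\mathcal M_d^{sa})^{m_k}$. Define $\Phi_d:U(d)^\ell\times E_d\to E_d$ by $\Phi_d((U_k)_k,(\mathbf A_k)_k,(\mathbf B_k)_k)=((U_k^*\mathbf A_kU_k)_k,(U_k^*\mathbf B_kU_k)_k)$, where conjugation is applied entrywise. For a regular Borel probability measure $\mu$ on $E_d$ put $\chi_{\mathrm{orb},R}(\mathbf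 Z_1,\ldots,\mathbf Z_\ell;M,d,\epsilon;\mu)=\log\big((\gamma_d^{\otimes\ell}\otimes\mu)(\Phi_d^{-1}(\Gamma_R(\mathbf X_1,\ldots,\mathbf X_\ell\sqcup\mathbf Y_1,\ldots,\mathbf Y_\ell;M,d,\epsilon)))\big)$; let $\chi_{\mathrm{orb},R}(\cdot;M,d,\epsilon)$ be the supremum over all such $\mu$; $\chi_{\mathrm{orb},R}(\cdot;M,\epsilon)=\limsup_{d\to\infty}\frac1{d^2}\chi_{\mathrm{orb},R}(\cdot;M,d,\epsilon)$; $\chi_{\mathrm{orb},R}(\cdot)=\inf_{M\in\mathbb N,\epsilon>0}\chi_{\mathrm{orb},R}(\cdot;M,\epsilon)$; and $\chi_{\mathrm{orb}}(\mathbf Z_1,\ldots,\mathbf Z_\ell)=\sup_{0<R<\infty}\chi_{\mathrm{orb},R}(\mathbf Z_1,\ldots,\mathbf Z_\ell)\in[-\infty,0]$. *)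

(* Defs.v *)
From HB Require Import structures.
From mathcomp Require Import all_boot all_order all_algebra complex.
From mathcomp Require Import all_classical all_reals all_analysis.
From mathcomp Require Import ring lra.

Set Implicit Arguments.
Unset Strict Implicit.
Unset Printing Implicit Defensive.

Import Order.TTheory GRing.Theory Num.Theory.
Import numFieldNormedType.Exports.

Local Open Scope classical_set_scope.
Local Open Scope complex_scope.
Local Open Scope sesquilinear_scope.
Local Open Scope ring_scope.

HB.instance Definition _ (R : rcfType) := PseudoMetric.copy R[i] R[i]^o.
HB.instance Definition _ (R : rcfType) := Pointed.copy R[i] R[i]^o.

(** [algType] and [completeNormedModType] have no common HB structure, hence
    a real-valued norm and completeness for Cauchy sequences as fields.
    Nonnegativity of the norm follows from the other axioms. *)
Record cstar_algebra (R : realType) := CStarAlgebra {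
  cstar_carrier :> algType R[i];
  star : cstar_carrier -> cstar_carrier;
  cstar_norm : cstar_carrier -> R;
  starK : involutive star;
  starD : {morph star : x y / x + y};
  starZ : forall a x, star (a *: x) = Num.conj a *: star x;
  starM : forall x y, star (x * y) = star y * star x;
  cstar_norm_eq0 : forall x, cstar_norm x = 0 -> x = 0;
  cstar_normD : forall x y, cstar_norm (x + y) <= cstar_norm x + cstar_norm y;
  cstar_normZ : forall a x, cstar_norm (a *: x) = Normc.normc a * cstar_norm x;
  cstar_normM : forall x y, cstar_norm (x * y) <= cstar_norm x * cstar_norm y;
  cstar_identity : forall x, cstar_norm (star x * x) = cstar_norm x ^+ 2;
  cstar_complete : forall u : nat -> cstar_carrier,
    (forall e : R, 0 < e -> exists N : nat, forall p q : nat,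
       (N <= p)%N -> (N <= q)%N -> cstar_norm (u p - u q) < e) ->
    exists x, (fun p => cstar_norm (u p - x)) @ \oo --> (0 : R) }.

Record cstar_state (R : realType) (A : cstar_algebra R) := CStarState {
  state_fun :> {scalar A};
  state_ge0 : forall x : A, 0 <= state_fun (star x * x);
  state1 : state_fun 1 = 1 }.

Definition generated_algebra (R : realType) (A : cstar_algebra R)
    (S : set A) : set A :=
  smallest [set B : set A | GRing.subalg_closed (mem B)] S.

Definition lr_variables (I J T : Type) (X : I -> T) (Y : J -> T) : I + J -> T :=
  fun k => match k with inl i => X i | inr j => Y j end.

(** Left and right variables commute in distribution only: [X i * Y j] and
    [Y j * X i] may differ in [A]. *)
Record tracially_bipartite (R : realType) (A : cstar_algebra R)
    (phi : cstar_state A) (I J : finType) (X : I -> A) (Y : J -> A) : Prop :=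
  TraciallyBipartite {
  bipartite_saX : forall i, star (X i) = X i;
  bipartite_saY : forall j, star (Y j) = Y j;
  bipartite_comm : forall (i : I) (j : J) (u v : seq (I + J)),
    let Z := lr_variables X Y in
    phi ((\prod_(k <- u) Z k) * X i * Y j * (\prod_(k <- v) Z k)) =
    phi ((\prod_(k <- u) Z k) * Y j * X i * (\prod_(k <- v) Z k));
  bipartite_traceX : forall a b, generated_algebra (range X) a ->
    generated_algebra (range X) b -> phi (a * b) = phi (b * a);
  bipartite_traceY : forall a b, generated_algebra (range Y) a ->
    generated_algebra (range Y) b -> phi (a * b) = phi (b * a) }.

Notation borel T := (g_sigma_algebraType (@open T)).

Record samx (R : realType) (d : nat) := SelfAdjoint {
  samx_val :> 'M[R[i]]_d;
  samxP : samx_val ^t* == samx_val }.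

HB.instance Definition _ R d := [isSub for @samx_val R d].
HB.instance Definition _ R d := [Choice of samx R d by <:].
HB.instance Definition _ R d :=
  Topological.copy (samx R d) (initial_topology (@samx_val R d)).

Lemma samx0_subproof (R : realType) d : (0 : 'M[R[i]]_d) ^t* == 0.
Proof. by rewrite trmx0 map_mx0. Qed.

HB.instance Definition _ R d :=
  isPointed.Build (samx R d) (SelfAdjoint (samx0_subproof R d)).

Record unitary_group (R : realType) (d : nat) := Unitary {
  unitary_mx :> 'M[R[i]]_d;
  unitaryP : unitary_mx \is unitarymx }.

HB.instance Definition _ R d := [isSub for @unitary_mx R d].
HB.instance Definition _ R d := [Choice of unitary_group R d by <:].
HB.instance Definition _ R d :=
  Topological.copy (unitary_group R d) (initial_topology (@unitary_mx R d)).

Lemma unitary1_subproof (R : realType) d : (1%:M : 'M[R[i]]_d) \is unitarymx.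
Proof. by apply/unitarymxP; rewrite trmx1 map_mx1 mulmx1. Qed.

HB.instance Definition _ R d :=
  isPointed.Build (unitary_group R d) (Unitary (unitary1_subproof R d)).

Definition unitary_mul (R : realType) d (U V : unitary_group R d) : unitary_group R d :=
  Unitary (mul_unitarymx (unitaryP U) (unitaryP V)).

Lemma unitary_conj_subproof (R : realType) d (U : unitary_group R d)
    (A : samx R d) : (U ^t* *m A *m U) ^t* == U ^t* *m A *m U.
Proof.
by rewrite !trmx_mul !map_mxM /= trmxCK (eqP (samxP A)) mulmxA.
Qed.

Definition unitary_conj (R : realType) d (U : unitary_group R d) (A : samx R d) :
  samx R d := SelfAdjoint (unitary_conj_subproof U A).

Definition haar_probability (R : realType) d
    (gamma : probability (borel (unitary_group R d)) R) : Prop :=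
  forall (U : unitary_group R d) (S : set (borel (unitary_group R d))), measurable S ->
    gamma (unitary_mul U @^-1` S) = gamma S /\
    gamma ((fun V => unitary_mul V U) @^-1` S) = gamma S.

Definition l2norm (R : realType) d (v : 'cV[R[i]]_d) : R :=
  Num.sqrt (\sum_i Normc.normc (v i 0) ^+ 2).

Definition opnorm (R : realType) d (A : 'M[R[i]]_d) : R :=
  sup [set l2norm (A *m v) | v in [set v : 'cV[R[i]]_d | l2norm v <= 1]].

Definition ntrace (R : realType) d (A : 'M[R[i]]_d) : R[i] := d%:R^-1 * \tr A.

Section measure_power.
Context d (T : measurableType d) (R : realType).
Variable mu : {sigma_finite_measure set T -> \bar R}.

Definition tuple_cons n (x : T * n.-tuple T) : n.+1.-tuple T :=
  [tuple of x.1 :: x.2].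

Lemma measurable_tuple_cons n : measurable_fun setT (@tuple_cons n).
Proof. exact: measurable_cons. Qed.

Section step.
Variables (n : nat) (nu : {sigma_finite_measure set (n.-tuple T) -> \bar R}).

Definition mpower_step : set (n.+1.-tuple T) -> \bar R :=
  pushforward (mu \x nu)%E (@tuple_cons n).

Let measurable_preimage_cons (A : set (n.+1.-tuple T)) :
  measurable A -> measurable (@tuple_cons n @^-1` A).
Proof. by move=> mA; rewrite -[X in measurable X]setTI; exact: measurable_tuple_cons. Qed.

Let mpower_step0 : mpower_step set0 = 0%E.
Proof. by rewrite /mpower_step /pushforward preimage_set0 measure0. Qed.

Let mpower_step_ge0 A : (0 <= mpower_step A)%E.
Proof. exact: (measure_ge0 (mu \x nu)%E). Qed.

Let mpower_step_additive : semi_sigma_additive mpower_step.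
Proof.
move=> F mF tF mUF; rewrite /mpower_step /pushforward preimage_bigcup.
apply: measure_semi_sigma_additive.
- by move=> k; exact: measurable_preimage_cons.
- apply/trivIsetP => /= i j _ _ ij; rewrite -preimage_setI.
  by move/trivIsetP : tF => /(_ _ _ _ _ ij) ->//; rewrite preimage_set0.
- by rewrite -preimage_bigcup; exact: measurable_preimage_cons.
Qed.

HB.instance Definition _ := isMeasure.Build _ _ _ mpower_step
  mpower_step0 mpower_step_ge0 mpower_step_additive.

Let mpower_step_sigma_finite : sigma_finite setT mpower_step.
Proof.
have /sigma_finiteP[F [TF ndF Foo]] := sigma_finiteT mu.
have /sigma_finiteP[G [TG ndG Goo]] := sigma_finiteT nu.
pose uncons (t : n.+1.-tuple T) : T * n.-tuple T := (thead t, [tuple of behead t]).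
have muncons : measurable_fun setT uncons.
  apply/measurable_fun_pairP; split; first exact: measurable_tnth.
  exact: measurable_behead.
have consK t : uncons (@tuple_cons n t) = t.
  case: t => x t; rewrite /uncons/= /tuple_cons /=; congr pair.
  exact/val_inj.
exists (fun k => uncons @^-1` (F k `*` G k)).
  rewrite -preimage_bigcup (_ : \bigcup_k _ = setT) ?preimage_setT//.
  rewrite -setXTT TF TG predeqE => -[x y]; split.
    by move=> [k _ []/= ? ?]; split; exists k.
  move=> [/= [k _ Fkx] [p _ Gpy]]; exists (maxn k p) => //; split.
  - by move: x Fkx; exact/subsetPset/ndF/leq_maxl.
  - by move: y Gpy; exact/subsetPset/ndG/leq_maxr.
move=> k; have [mF Fk] := Foo k; have [mG Gk] := Goo k; split.
  rewrite -[X in measurable X]setTI; apply: muncons => //.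
  exact: measurableX.
rewrite /mpower_step /pushforward -comp_preimage.
rewrite (_ : uncons \o _ = id); last by apply/funext => t; exact: consK.
by rewrite preimage_id product_measure1E// lte_mul_pinfty// ge0_fin_numE.
Qed.

HB.instance Definition _ := Measure_isSigmaFinite.Build _ _ _ mpower_step
  mpower_step_sigma_finite.

End step.

Fixpoint mpower n : {sigma_finite_measure set (n.-tuple T) -> \bar R} :=
  if n is n.+1 then mpower_step (mpower n) else dirac [tuple].

End measure_power.

(** Coordinates on the self-adjoint matrices in a basis that is orthonormal
    for [\tr (A *m B)], whence the factors [1 / sqrt 2] off the diagonal; see
    [samx_coord_isometry]. *)
Definition samx_coord_mx (R : realType) d (x : 'I_d -> 'I_d -> R) :
    'M[R[i]]_d :=
  \matrix_(i, j)
    if i == j then (x i i)%:C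
    else if (i < j)%N then (x i j / Num.sqrt 2) +i* (x j i / Num.sqrt 2)
    else (x j i / Num.sqrt 2) -i* (x i j / Num.sqrt 2).

Lemma samx_coord_subproof (R : realType) d (x : 'I_d -> 'I_d -> R) :
  (samx_coord_mx x) ^t* == samx_coord_mx x.
Proof.
apply/eqP/matrixP => i j; rewrite !mxE eq_sym.
case: eqVneq => [->|ij]; first by rewrite -[LHS]/(conjc _) /= oppr0.
have [h|h|/val_inj h] := ltngtP i j.
- by rewrite -[LHS]/(conjc _) /= opprK.
- by [].
- by rewrite h eqxx in ij.
Qed.

Definition samx_coord (R : realType) d (x : 'I_d -> 'I_d -> R) :
  samx R d := SelfAdjoint (samx_coord_subproof x).

Lemma samx_coord_isometry (R : realType) d (x y : 'I_d -> 'I_d -> R) :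
  \tr (samx_coord x *m samx_coord y) =
  (\sum_i \sum_j x i j * y i j)%:C.
Proof.
pose f i j := samx_coord x i j * samx_coord y j i.
pose g i j := (x i j * y i j)%:C.
have fg i j : f i j + f j i = g i j + g j i.
  rewrite /f /g !mxE /= ![j == i]eq_sym; case: eqVneq => [->|ij].
    by rewrite -!rmorphM.
  have s2 : (Num.sqrt 2 : R)^-1 * (Num.sqrt 2)^-1 = 2^-1.
    by rewrite -invfM -expr2 sqr_sqrtr.
  have [h|h|/val_inj h] := ltngtP i j; last by rewrite h eqxx in ij.
    apply/eqP; rewrite eq_complex /=; apply/andP; split; apply/eqP; last by ring.
    have -> : forall a b c e w : R, a * w * (c * w) - b * w * - (e * w)
        + (a * w * (c * w) - - (b * w) * (e * w)) = 2 * (w * w) * (a * c + b * e).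
      by move=> *; ring.
    by rewrite s2 mulfV// mul1r.
  apply/eqP; rewrite eq_complex /=; apply/andP; split; apply/eqP; last by ring.
  have -> : forall a b c e w : R, a * w * (c * w) - - (b * w) * (e * w)
      + (a * w * (c * w) - b * w * - (e * w)) = 2 * (w * w) * (b * e + a * c).
    by move=> *; ring.
  by rewrite s2 mulfV// mul1r.
have -> : \tr (samx_coord x *m samx_coord y) = \sum_i \sum_j f i j.
  by apply: eq_bigr => i _; rewrite mxE.
have -> : (\sum_i \sum_j x i j * y i j)%:C = \sum_i \sum_j g i j.
  by rewrite rmorph_sum; apply: eq_bigr => i _; rewrite rmorph_sum.
have dbl h : (\sum_i \sum_j h i j) *+ 2 =
    \sum_(i < d) \sum_(j < d) (h i j + h j i) :> R[i].
  rewrite mulr2n [X in _ + X]exchange_big -big_split /=.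
  by apply: eq_bigr => i _; rewrite -big_split.
have : (\sum_i \sum_j f i j) *+ 2 = (\sum_i \sum_j g i j) *+ 2.
  by rewrite !dbl; apply: eq_bigr => i _; apply: eq_bigr => j _; exact: fg.
by move/eqP; rewrite -subr_eq0 -mulrnBl mulrn_eq0 /= subr_eq0 => /eqP.
Qed.

Definition samx_family (R : realType) (d : nat) (K : finType) : Type :=
  {ptws K -> samx R d}.

HB.instance Definition _ R d K :=
  Topological.copy (samx_family R d K) {ptws K -> samx R d}.
HB.instance Definition _ R d K :=
  isPointed.Build (samx_family R d K) (fun _ => point).

Definition samx_family_coord (R : realType) d (K : finType)
    (t : #|{: K * 'I_d * 'I_d}|.-tuple R) : samx_family R d K :=
  fun k => samx_coord (fun i j => tnth t (enum_rank (k, i, j))).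

Definition samx_lebesgue (R : realType) d (K : finType)
    (S : set (samx_family R d K)) : \bar R :=
  mpower (@lebesgue_measure R) #|{: K * 'I_d * 'I_d}|
    (@samx_family_coord R d K @^-1` S).

Section entropy.
Context (R : realType) (A : cstar_algebra R) (phi : cstar_state A).

Definition microstates (I J : finType) (X : I -> A) (Y : J -> A)
    (r : R) (M d : nat) (eps : R) :
    set (samx_family R d (I + J)%type) :=
  [set F | (forall k, opnorm (F k) <= r) /\
    forall (p : seq I) (q : seq J), (1 <= size p + size q <= M)%N ->
      Normc.normc
        (phi ((\prod_(i <- p) X i) * (\prod_(j <- q) Y j))
         - ntrace ((\prod_(i <- p) (F (inl i) : 'M[R[i]]_d))
                   * (\prod_(j <- rev q) (F (inr j) : 'M[R[i]]_d)))) < eps].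

Arguments microstates {I J} X Y r M d eps.

Definition chi_fin (I J : finType) (X : I -> A) (Y : J -> A)
    (r : R) (M d : nat) (eps : R) : \bar R :=
  lne (samx_lebesgue (microstates X Y r M d eps)).

(** [lne 0 = -oo], whereas [ln 0 = 0]; the value at [d = 0] is irrelevant to
    the limit superior. *)
Definition chi_limsup (I J : finType) (X : I -> A) (Y : J -> A)
    (r : R) (M : nat) (eps : R) : \bar R :=
  limn_esup (fun d : nat =>
    ((d%:R ^+ 2)^-1)%:E * chi_fin X Y r M d eps
    + ((#|I| + #|J|)%N%:R / 2 * ln d%:R)%:E)%E.

Definition chi_cutoff (I J : finType) (X : I -> A) (Y : J -> A) (r : R) :
    \bar R :=
  ereal_inf [set z | exists (M : nat) (eps : R),
    0 < eps /\ z = chi_limsup X Y r M eps].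

Definition chi (I J : finType) (X : I -> A) (Y : J -> A) : \bar R :=
  ereal_sup [set chi_cutoff X Y r | r in [set r : R | 0 < r]].

End entropy.

Arguments microstates {R A} phi {I J} X Y r M d eps.

Definition regular_measure (R : realType) (T : ptopologicalType)
    (mu : {measure set (borel T) -> \bar R}) : Prop :=
  forall S : set (borel T), measurable S ->
    mu S = ereal_inf [set mu U | U in [set U : set T | open U /\ S `<=` U]] /\
    mu S = ereal_sup [set mu K | K in [set K : set T | compact K /\ K `<=` S]].

(** The variables of all the families, indexed by pairs (k, i).  Entropies are
    defined for finite index types, so no enumeration of the pairs is chosen. *)
Definition joint_family (l : nat) (n : 'I_l -> nat) (T : Type)
    (X : forall k, 'I_(n k) -> T) : {k : 'I_l & 'I_(n k)} -> T :=
  fun t => X (tag t) (tagged t).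

Section orbital_entropy.
Context (R : realType) (A : cstar_algebra R) (phi : cstar_state A).
Variable gamma : forall d, probability (borel (unitary_group R d)) R.
Variables (l : nat) (n m : 'I_l -> nat).
Variables (X : forall k, 'I_(n k) -> A) (Y : forall k, 'I_(m k) -> A).

Local Notation orbital_space d := (samx_family R d
  ({k : 'I_l & 'I_(n k)} + {k : 'I_l & 'I_(m k)})%type).

Definition orbital_map (d : nat)
    (UF : l.-tuple (borel (unitary_group R d)) * borel (orbital_space d)) :
    orbital_space d :=
  fun t => unitary_conj
    (tnth UF.1 (match t with inl s => tag s | inr s => tag s end)) (UF.2 t).

Definition chi_orb_fin_measure (r : R) (M d : nat) (eps : R)
    (mu : probability (borel (orbital_space d)) R) : \bar R :=
  lne ((mpower (gamma d) l \x mu)%E (@orbital_map d @^-1`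
    microstates phi (joint_family X) (joint_family Y) r M d eps)).

Definition chi_orb_fin (r : R) (M d : nat) (eps : R) : \bar R :=
  ereal_sup [set chi_orb_fin_measure r M eps mu |
    mu in [set mu : probability (borel (orbital_space d)) R |
           regular_measure mu]].

Definition chi_orb_limsup (r : R) (M : nat) (eps : R) : \bar R :=
  limn_esup (fun d : nat => ((d%:R ^+ 2)^-1)%:E * chi_orb_fin r M d eps)%E.

Definition chi_orb_cutoff (r : R) : \bar R :=
  ereal_inf [set z | exists (M : nat) (eps : R),
    0 < eps /\ z = chi_orb_limsup r M eps].

Definition chi_orb : \bar R :=
  ereal_sup [set chi_orb_cutoff r | r in [set r : R | 0 < r]].

End orbital_entropy.

(* Main.v *)
(** The averaged form of the orbital entropy is tested against Dirac measures,
    whose regularity is immediate.  Conjugating every family by its own unitary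
    preserves the Lebesgue measure and the product [P] of the microstate spaces
    of the families, which contains the joint microstates [G].  Averaging
    [lambda G] over the unitaries and exchanging the integrals gives
    [lambda G <= s * lambda P], where [s] is the supremum over the matrix
    families [F] of the probability that a random conjugate of [F] is in [G];
    and [log s] is at most the orbital entropy at [(M, d, eps)].  The limits are
    then subadditive because the orbital term is at most [0] and the entropies
    of the families are bounded above in [d], by a Gaussian volume estimate;
    this excludes sums [-oo + +oo], which are [-oo] in the library.

    The invariance of the Lebesgue measure under linear isometries and its
    factorization along blocks of coordinates both come from the uniqueness of
    shift-invariant measures. *)

From HB Require Import structures.
Require Import Defs.
From mathcomp Require Import all_boot all_order all_algebra complex.
From mathcomp Require Import all_classical all_reals all_analysis.
From mathcomp Require Import measurable_realfun ring lra.

Set Implicit Arguments.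
Unset Strict Implicit.
Unset Printing Implicit Defensive.

Import Order.TTheory GRing.Theory Num.Theory.
Import numFieldNormedType.Exports.

Local Open Scope classical_set_scope.
Local Open Scope complex_scope.
Local Open Scope sesquilinear_scope.
Local Open Scope ring_scope.

(** * Powers of a measure and shift-invariant measures *)

(** Two kinds of measurable space meet in the averaging: the Borel sets of the unitary group and of
    the matrix families, on which [gamma] and the test measures live, and the product sigma-algebra
    of the coordinate tuples, which carries the Lebesgue measure. Measurability of the microstate
    spaces is therefore proved for entrywise measurable maps out of an arbitrary measurable space,
    and one statement serves every combination. Two countability facts support it: there are
    countably many words, and the operator norm, a supremum over uncountably many vectors, is
    decided by vectors of Gaussian integers.

    The number [s] of the overview enters as the exponential of the orbital entropy at (M, d, eps).
    It is 0 when that entropy is -oo, hence no case distinction is made there, and it is at most 1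
    because probabilities are.

    The finite-dimensional estimate uses the same [r], [M] and [eps] on both sides. The infima over
    [M] and [eps] are nevertheless taken separately in each summand on the right; they are
    recombined by the monotonicity of each summand along the directed set of pairs. *)

Lemma measurable_preimage d1 d2 (T1 : measurableType d1) (T2 : measurableType d2)
    (f : T1 -> T2) (A : set T2) :
  measurable_fun setT f -> measurable A -> measurable (f @^-1` A).
Proof. by move=> mf mA; rewrite -[X in measurable X]setTI; exact: mf. Qed.

Lemma exchange_measure_section d1 d2 (T1 : measurableType d1)
    (T2 : measurableType d2) (R : realType)
    (m1 : {sigma_finite_measure set T1 -> \bar R})
    (m2 : {sigma_finite_measure set T2 -> \bar R}) (A : set (T1 * T2)) :
  measurable A ->
  (\int[m1]_x m2 [set y | A (x, y)] = \int[m2]_y m1 [set x | A (x, y)])%E.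
Proof.
move=> mA; have := indic_fubini_tonelli m1 m2 mA.
rewrite indic_fubini_tonelli_FE// indic_fubini_tonelli_GE//.
have xE x : xsection A x = [set y | A (x, y)].
  by rewrite /xsection; apply/seteqP; split=> t /=; rewrite inE.
have yE y : ysection A y = [set x | A (x, y)].
  by rewrite /ysection; apply/seteqP; split=> t /=; rewrite inE.
by under eq_integral do rewrite /= xE; under [RHS]eq_integral do rewrite /= yE.
Qed.

Section mpower_theory.
Context d (T : measurableType d) (R : realType).
Variable mu : {sigma_finite_measure set T -> \bar R}.

Lemma ge0_integral_mpowerS n (f : n.+1.-tuple T -> \bar R) :
  measurable_fun [set: n.+1.-tuple T] f -> (forall t, 0 <= f t)%E ->
  (\int[mpower mu n.+1]_t f t =
   \int[mu]_x \int[mpower mu n]_t f (tuple_cons (x, t)))%E.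
Proof.
move=> mf f0; transitivity
    (\int[pushforward (mu \x mpower mu n) (@tuple_cons _ T n)]_t f t)%E => //.
rewrite ge0_integral_pushforward//; last exact: measurable_tuple_cons.
rewrite preimage_setT fubini_tonelli1//.
by apply: measurableT_comp => //; exact: measurable_tuple_cons.
by move=> t /=; exact: f0.
Qed.

Lemma mpowerSE n (A : set (n.+1.-tuple T)) :
  mpower mu n.+1 A =
  (\int[mu]_x mpower mu n [set t | A (tuple_cons (x, t))])%E.
Proof.
rewrite /= /mpower_step /pushforward /product_measure1.
apply: eq_integral => x _ /=; congr (_ _).
by rewrite /xsection; apply/seteqP; split=> t /=; rewrite inE.
Qed.

Lemma mpower_setT n : mu setT = 1%E -> mpower mu n setT = 1%E.
Proof.
move=> mu1; elim: n => [|n ih]; first by rewrite /= diracT.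
rewrite mpowerSE.
under eq_integral do rewrite (_ : [set _ | _] = setT) ?ih//.
by rewrite integral_cst// mul1e; exact: mu1.
Qed.

Lemma measurable_prod_tnth n (f : T -> R) : measurable_fun setT f ->
  measurable_fun [set: n.-tuple T] (fun t => \prod_(i < n) f (tnth t i)).
Proof.
move=> mf; apply: measurable_prod => i _.
by apply: measurableT_comp => //; exact: measurable_tnth.
Qed.

(** Tonelli, one coordinate at a time. It gives the volume of the unit cube from an indicator and
    the total mass of a Gaussian in several variables. *)
Lemma integral_mpower_prod n (f : T -> R) (c : R) :
  measurable_fun setT f -> (forall x, 0 <= f x) ->
  (\int[mu]_x (f x)%:E = c%:E)%E ->
  (\int[mpower mu n]_t (\prod_(i < n) f (tnth t i))%:E = (c ^+ n)%:E)%E.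
Proof.
move=> mf f0 fc; elim: n => [|n ih].
  under eq_integral do rewrite big_ord0.
  by rewrite integral_cst//= diracT mule1 expr0.
rewrite ge0_integral_mpowerS; first last.
- by move=> t; rewrite lee_fin prodr_ge0.
- by apply/measurable_EFinP; exact: measurable_prod_tnth.
transitivity (\int[mu]_x ((f x)%:E * (c ^+ n)%:E))%E.
  apply: eq_integral => x _; rewrite -ih -ge0_integralZl//; first last.
  - by rewrite lee_fin.
  - by move=> t _; rewrite lee_fin prodr_ge0.
  - by apply/measurable_EFinP; exact: measurable_prod_tnth.
  apply: eq_integral => t _; rewrite -EFinM big_ord_recl /tuple_cons tnth0.
  by congr ((_ * _)%:E); apply: eq_bigr => i _; rewrite tnthS.
have c0 : 0 <= c by rewrite -lee_fin -fc integral_ge0// => x _; rewrite lee_fin.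
rewrite ge0_integralZr//.
- by rewrite fc -EFinM exprS.
- exact/measurable_EFinP.
- by move=> x _; rewrite lee_fin.
- by rewrite lee_fin exprn_ge0.
Qed.

End mpower_theory.

(** * Lebesgue measure on tuples: translations and uniqueness *)

Section lebesgue_power.
Context {R : realType}.
Local Notation RT := (measurableTypeR R).
Local Notation lam N := (mpower (@lebesgue_measure R) N).

(** The translated measure agrees with Lebesgue measure on half-open intervals, which determine
    it. *)
Lemma lebesgue_measure_shift (s : R) (A : set RT) : measurable A ->
  lebesgue_measure ((fun x => s + x) @^-1` A) = lebesgue_measure A.
Proof.
move=> mA.
have ms : measurable_fun [set: RT] (fun x : RT => (s + x : RT)).
  exact: measurable_funD.
rewrite -[LHS]/(pushforward lebesgue_measure (fun x : RT => (s + x : RT)) A).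
apply/esym/lebesgue_measure_unique => //= _ [[a b]] /= _ <-.
rewrite /pushforward.
have -> : ([eta +%R s] @^-1` `]a, b]%classic) = (`]a - s, b - s]%classic : set R).
  apply/seteqP; split=> x /=; rewrite !in_itv /=; lra.
rewrite !lebesgue_measure_itv /= !lte_fin ltrD2r.
case: ifPn => // _; rewrite -!EFinB; congr EFin; lra.
Qed.

Definition tuple_add N (s t : N.-tuple RT) : N.-tuple RT :=
  [tuple (tnth s i + tnth t i : R) | i < N].

Definition tuple_opp N (s : N.-tuple RT) : N.-tuple RT :=
  [tuple (- tnth s i : R) | i < N].

Lemma tuple_addKr N (s t : N.-tuple RT) : tuple_add s (tuple_add (tuple_opp s) t) = t.
Proof. by apply: eq_from_tnth => i; rewrite !tnth_mktuple addNKr. Qed.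

Lemma tuple_addC N (s t : N.-tuple RT) : tuple_add s t = tuple_add t s.
Proof. by apply: eq_from_tnth => i; rewrite !tnth_mktuple addrC. Qed.

Lemma tuple_add_cons N (s : N.+1.-tuple RT) (x : RT) (t : N.-tuple RT) :
  tuple_add s (tuple_cons (x, t)) =
  tuple_cons ((thead s + x : R) : RT, tuple_add [tuple of behead s] t).
Proof.
apply: eq_from_tnth => i; rewrite tnth_mktuple.
case: (unliftP ord0 i) => [j|] ->; rewrite /tuple_cons ?tnth0//.
by rewrite !tnthS tnth_mktuple [in LHS](tuple_eta s) tnthS.
Qed.

Lemma measurable_tuple_add d' (T : measurableType d') N (f g : T -> N.-tuple RT) :
  measurable_fun setT f -> measurable_fun setT g ->
  measurable_fun setT (fun x => tuple_add (f x) (g x)).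
Proof.
move=> mf mg; apply/measurable_fun_tnthP => i.
rewrite (_ : _ \o _ = (fun x => tnth (f x) i + tnth (g x) i : R)).
  apply: measurable_funD.
  - by move/measurable_fun_tnthP : mf => /(_ i).
  - by move/measurable_fun_tnthP : mg => /(_ i).
by apply/funext => x /=; rewrite tnth_mktuple.
Qed.

Lemma measurable_tuple_opp d' (T : measurableType d') N (f : T -> N.-tuple RT) :
  measurable_fun setT f -> measurable_fun setT (fun x => tuple_opp (f x)).
Proof.
move=> mf; apply/measurable_fun_tnthP => i.
rewrite (_ : _ \o _ = (fun x => - tnth (f x) i : R)).
  by apply: measurableT_comp => //; move/measurable_fun_tnthP : mf => /(_ i).
by apply/funext => x /=; rewrite tnth_mktuple.
Qed.

Lemma measurable_opp_preimage N (A : set (N.-tuple RT)) :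
  measurable A -> measurable (@tuple_opp N @^-1` A).
Proof.
move=> mA; rewrite -[X in measurable X]setTI.
by apply: (measurable_tuple_opp (f := id)).
Qed.

Lemma lebesgue_power_shift N (s : N.-tuple RT) (A : set (N.-tuple RT)) :
  measurable A -> lam N (tuple_add s @^-1` A) = lam N A.
Proof.
elim: N s A => [|N ih] s A mA.
  congr (dirac _ _); apply/funext => t /=; congr (A _).
  by rewrite (tuple0 t) (tuple0 (tuple_add _ _)).
(* The volume of a section: inside it the tail of the shift is removed by induction, and the head is
   then a one-dimensional shift under the outer integral. *)
pose g (x : RT) := lam N [set t | A (tuple_cons (x, t))].
have gE : g = fun x => lam N (xsection (@tuple_cons _ RT N @^-1` A) x).
  apply/funext => x; congr (lam _ _).
  by rewrite /xsection; apply/seteqP; split=> t /=; rewrite inE.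
have mA' : measurable (@tuple_cons _ RT N @^-1` A).
  by rewrite -[X in measurable X]setTI; exact: measurable_tuple_cons.
have mg : measurable_fun setT g.
  by rewrite gE; exact: measurable_fun_xsection.
pose sh (x : RT) : RT := (thead s + x : R).
have ms : measurable_fun [set: RT] sh by exact: measurable_funD.
rewrite !mpowerSE.
transitivity (\int[@lebesgue_measure R]_x g (sh x))%E.
  apply: eq_integral => x _.
  rewrite -[RHS](ih [tuple of behead s]).
    congr (lam _ _); apply/seteqP; split=> t /=;
      by rewrite tuple_add_cons.
  rewrite (_ : [set t | _] = xsection (@tuple_cons _ RT N @^-1` A) (sh x)).
    exact: measurable_xsection.
  by rewrite /xsection; apply/seteqP; split=> t /=; rewrite inE.
rewrite -[LHS](@ge0_integral_pushforward _ _ _ _ _ _ ms lebesgue_measure setT g)//.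
apply: eq_measure_integral => B mB _.
exact: lebesgue_measure_shift.
Qed.

Definition unit_cube N : set (N.-tuple RT) :=
  [set t | forall i, tnth t i \in `[0, 1]%R].

Lemma measurable_unit_cube N : measurable (@unit_cube N).
Proof.
rewrite (_ : @unit_cube N = \bigcap_(i : 'I_N) ((@tnth N RT)^~ i @^-1` `[0, 1]%classic)).
  apply: fin_bigcap_measurable => // i _.
  by apply: measurable_preimage => //; exact: measurable_tnth.
by apply/seteqP; split=> t /= h i; [move=> _; exact: h|exact: h].
Qed.

Lemma lebesgue_power_unit_cube N : lam N (@unit_cube N) = 1%E.
Proof.
have := @integral_mpower_prod _ _ _ (@lebesgue_measure R) N \1_`[0, 1] 1.
rewrite expr1n => /(_ _ _ _) <-//; first last.
- transitivity (@lebesgue_measure R `[0, 1]%classic).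
    by rewrite integral_indic// setIT.
  by rewrite lebesgue_measure_itv /= lte01 oppr0 addr0.
rewrite -[LHS]mul1e -integral_cst//; last exact: measurable_unit_cube.
rewrite integral_mkcond; apply: eq_integral => t _.
rewrite patchE; case: ifPn => [/set_mem h|/negP h] /=.
  by rewrite big1// => i _; rewrite indicE mem_set//=; exact: h.
have [i hi] : exists i, tnth t i \notin `[0, 1]%R.
  apply: contrapT => /forallNP h'; apply: h; apply/mem_set => i.
  by apply/negPn/negP/h'.
rewrite (bigD1 i)//= indicE memNset ?mul0r//=; exact/negP.
Qed.

(* Integrate [1_A (x + y) 1_B (y)], [B] the unit cube, over [nu x lam], and
   substitute [y - x] for [y]; taking [A = B] also gives [nu (- B) = nu B]. *)
Lemma shift_invariant_unique N
    (nu : {sigma_finite_measure set (N.-tuple RT) -> \bar R}) :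
  (forall s A, measurable A -> nu (tuple_add s @^-1` A) = nu A) ->
  forall A, measurable A -> nu A = (nu (@unit_cube N) * lam N A)%E.
Proof.
move=> nu_shift A mA.
set B := @unit_cube N; have mB : measurable B := @measurable_unit_cube N.
have nu_lam C : measurable C -> nu C = (nu (@tuple_opp N @^-1` B) * lam N C)%E.
  move=> mC.
  pose S1 : set (N.-tuple RT * N.-tuple RT) :=
    [set z | C (tuple_add z.1 z.2) /\ B z.2].
  pose S2 : set (N.-tuple RT * N.-tuple RT) :=
    [set z | C z.2 /\ B (tuple_add (tuple_opp z.1) z.2)].
  have mS1 : measurable S1.
    apply: measurableI; last exact: measurable_preimage.
    apply: measurable_preimage => //.
    exact: measurable_tuple_add.
  have mS2 : measurable S2.
    apply: measurableI; first exact: measurable_preimage.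
    apply: measurable_preimage => //.
    by apply: measurable_tuple_add => //; exact: measurable_tuple_opp.
  have := exchange_measure_section nu (lam N) mS1.
  have -> : (\int[nu]_x lam N [set y | S1 (x, y)] =
             \int[nu]_x lam N [set y | S2 (x, y)])%E.
    apply: eq_integral => x _.
    rewrite -[LHS](lebesgue_power_shift (tuple_opp x))//; last first.
      by apply: (measurable_preimage _ mS1); exact: measurable_pair1.
    congr (lam _ _); apply/seteqP; split=> y; rewrite /S1 /S2 /=;
      by rewrite tuple_addKr.
  rewrite (exchange_measure_section nu (lam N) mS2).
  have -> : (\int[lam N]_y nu [set x | S1 (x, y)] = nu C)%E.
    rewrite (_ : (fun y => _) = (fun y => nu C * (\1_B y)%:E)%E).
      rewrite ge0_integralZl//.
      - have -> : (\int[lam N]_x (\1_B x)%:E = 1)%E; last by rewrite mule1.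
        by rewrite -(lebesgue_power_unit_cube N) integral_indic// setIT.
      - exact/measurable_EFinP/measurable_indic.
    apply/funext => y; rewrite indicE; case: (pselect (B y)) => By.
      rewrite mem_set// mule1 -[RHS](nu_shift y)//.
      congr (nu _); apply/seteqP; split=> x; rewrite /S1 /= tuple_addC; tauto.
    rewrite memNset// mule0 -(measure0 nu); congr (nu _).
    by apply/seteqP; split=> x //= [].
  move=> <-.
  rewrite (_ : (fun y => _) = (fun y => nu (@tuple_opp N @^-1` B) * (\1_C y)%:E)%E).
    rewrite ge0_integralZl//.
    - by rewrite integral_indic// setIT.
    - exact/measurable_EFinP/measurable_indic.
  apply/funext => y; rewrite indicE; case: (pselect (C y)) => Cy.
    rewrite mem_set// mule1 -[RHS](nu_shift (tuple_opp y)); last exact: measurable_opp_preimage.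
    congr (nu _); apply/seteqP; split=> x; rewrite /S2 /=.
      move=> [_]; congr (B _); apply: eq_from_tnth => i.
      by rewrite !tnth_mktuple opprD opprK addrC.
    move=> h; split=> //; move: h; congr (B _); apply: eq_from_tnth => i.
    by rewrite !tnth_mktuple opprD opprK addrC.
  rewrite memNset// mule0 -(measure0 nu); congr (nu _).
  by apply/seteqP; split=> x //= [].
by rewrite nu_lam// [in RHS]nu_lam// lebesgue_power_unit_cube mule1.
Qed.

End lebesgue_power.

Section sigma_finite_copy.
Context d (T : measurableType d) (R : realType).
Variable nu : {measure set T -> \bar R}.

(** An alias of [nu] that carries the proof of sigma-finiteness in its type, so that the structure
    required by Tonelli can be attached to a measure for which this is a hypothesis. *)
Definition sigma_finite_copy of sigma_finite setT nu : set T -> \bar R := nu.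

Hypothesis nu_sf : sigma_finite setT nu.

HB.instance Definition _ := Measure.copy (sigma_finite_copy nu_sf) nu.
HB.instance Definition _ :=
  Measure_isSigmaFinite.Build _ _ _ (sigma_finite_copy nu_sf) nu_sf.

End sigma_finite_copy.

Section lebesgue_power_uniqueness.
Context {R : realType}.
Local Notation RT := (measurableTypeR R).
Local Notation lam N := (mpower (@lebesgue_measure R) N).

Lemma shift_invariant_measureE N (nu : {measure set (N.-tuple RT) -> \bar R}) :
  sigma_finite setT nu ->
  (forall s A, measurable A -> nu (tuple_add s @^-1` A) = nu A) ->
  forall A, measurable A -> nu A = (nu (@unit_cube R N) * lam N A)%E.
Proof.
move=> sf.
exact: (shift_invariant_unique (nu := sigma_finite_copy sf)).
Qed.

Definition sqr_sum N (t : N.-tuple RT) : R := \sum_(i < N) (tnth t i : R) ^+ 2.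

Lemma measurable_sqr_sum N : measurable_fun setT (@sqr_sum N).
Proof.
apply: measurable_sum => i.
apply: measurable_funX; exact: measurable_tnth.
Qed.

Lemma measurable_sqr_sum_le N (rho : R) : measurable [set t : N.-tuple RT | sqr_sum t <= rho].
Proof.
rewrite (_ : [set t | _] = @sqr_sum N @^-1` `]-oo, rho]%classic).
  by apply: measurable_preimage => //; exact: measurable_sqr_sum.
by apply/seteqP; split=> t /=; rewrite in_itv.
Qed.

(** The centred Gaussian density of variance [s ^+ 2] has integral 1, and on [A] it is at least its
    value at squared radius [rho]. *)
Lemma lebesgue_power_gauss_bound N (s rho : R) (A : set (N.-tuple RT)) :
  s != 0 -> measurable A -> (forall t, A t -> sqr_sum t <= rho) ->
  ((normal_peak s ^+ N * expR (- rho / (s ^+ 2 *+ 2)))%:E * lam N A <= 1)%E.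
Proof.
move=> s0 mA Arho.
have := @integral_mpower_prod _ _ _ (@lebesgue_measure R) N (normal_pdf 0 s) 1
  (measurable_normal_pdf 0 s) (normal_pdf_ge0 0 s) (integral_normal_pdf 0 s).
rewrite expr1n => <-.
rewrite -integral_cst//.
have mf : measurable_fun [set: N.-tuple RT]
    (fun t => (\prod_(i < N) normal_pdf 0 s (tnth t i))%:E).
  apply/measurable_EFinP; apply: measurable_prod_tnth.
  exact: measurable_normal_pdf.
have f0 (t : N.-tuple RT) :
    (0 <= (\prod_(i < N) normal_pdf 0 s (tnth t i))%:E)%E.
  by rewrite lee_fin prodr_ge0// => i _; exact: normal_pdf_ge0.
apply: (@le_trans _ _
    (\int[lam N]_(t in A) (\prod_(i < N) normal_pdf 0 s (tnth t i))%:E)%E).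
  apply: ge0_le_integral => //.
  - by move=> t _; rewrite lee_fin mulr_ge0 ?expR_ge0// exprn_ge0// ltW// normal_peak_gt0.
  - exact: measurable_funTS.
  move=> t At; rewrite lee_fin.
  under eq_bigr do rewrite normal_pdfE// /normal_fun subr0.
  rewrite big_split /= big_const iter_mulr_1 card_ord.
  rewrite ler_pM2l ?exprn_gt0 ?normal_peak_gt0//.
  rewrite -expR_sum ler_expR -mulr_suml sumrN.
  rewrite ler_pM2r ?lerN2 ?Arho// invr_gt0 mulrn_wgt0// exprn_even_gt0//.
exact: ge0_subset_integral.
Qed.

Lemma lebesgue_power_bounded N (rho : R) (A : set (N.-tuple RT)) :
  measurable A -> (forall t, A t -> sqr_sum t <= rho) -> (lam N A < +oo)%E.
Proof.
move=> mA /(lebesgue_power_gauss_bound (oner_neq0 R) mA).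
set c := (_ * _)%R; have c0 : 0 < c.
  by rewrite mulr_gt0 ?expR_gt0// exprn_gt0// normal_peak_gt0// oner_neq0.
have [|] := ltP (lam N A) +oo%E; first by [].
by rewrite leye_eq => /eqP ->; rewrite gt0_muley ?lte_fin// leye_eq.
Qed.

(** The image measure is shift invariant since [f] is additive and onto, hence a multiple of
    Lebesgue measure. The factor is 1 because balls are invariant and have finite nonzero volume. *)
Lemma isometry_lebesgue_power N (f g : N.-tuple RT -> N.-tuple RT) :
  measurable_fun setT f ->
  (forall s t, f (tuple_add s t) = tuple_add (f s) (f t)) ->
  cancel g f ->
  (forall t, sqr_sum (f t) = sqr_sum t) ->
  forall A, measurable A -> lam N (f @^-1` A) = lam N A.
Proof.
move=> mf fD gK fiso.
pose ball n := [set t : N.-tuple RT | sqr_sum t <= n%:R].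
have mball n : measurable (ball n) by exact: measurable_sqr_sum_le.
have fball n : f @^-1` (ball n) = ball n.
  by apply/seteqP; split=> t /=; rewrite /ball /= fiso.
have ball_fin n : (lam N (ball n) < +oo)%E by exact: (@lebesgue_power_bounded _ n%:R).
pose nu : {measure set (N.-tuple RT) -> \bar R} :=
  measure_function_pushforward__canonical__measure_function_Measure (lam N) mf.
have nuE A : nu A = lam N (f @^-1` A) by [].
have nu_sf : sigma_finite setT nu.
  exists ball.
    apply/seteqP; split=> t // _.
    exists (Num.truncn (sqr_sum t)).+1 => //=; apply/ltW/truncnS_gt.
  by move=> n; split; [exact: mball|rewrite nuE fball].
(* A shift by [s] after [f] is a shift by [g s] before it. *)
have nu_shift s A : measurable A -> nu (tuple_add s @^-1` A) = nu A.
  move=> mA; rewrite !nuE -[RHS](lebesgue_power_shift (g s)).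
    by congr (lam N _); apply/seteqP; split=> t /=; rewrite fD gK.
  exact: measurable_preimage.
have nuA := shift_invariant_measureE nu_sf nu_shift.
suff c1 : nu (@unit_cube R N) = 1%E.
  by move=> A mA; rewrite -nuE nuA// c1 mul1e.
(* The ball of squared radius [N] contains the unit cube, so its volume is at least 1 and can be
   cancelled. *)
have cube_ball : @unit_cube R N `<=` ball N.
  move=> t h; rewrite /ball /= /sqr_sum.
  rewrite -[leRHS]mulr1 -[in leRHS](card_ord N) mulr_natl -sumr_const.
  apply: ler_sum => i _; have := h i; rewrite in_itv /= => /andP[t0 t1].
  by rewrite expr_le1.
have ball1 : (1 <= lam N (ball N))%E.
  rewrite -(lebesgue_power_unit_cube N) le_measure// inE//.
  exact: measurable_unit_cube.
have := nuA _ (mball N); rewrite nuE fball.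
have := ball_fin N; case: (lam N (ball N)) ball1 => [b| |]//=.
rewrite lee_fin => b1 _.
have b0 : 0 < b by rewrite (lt_le_trans _ b1).
case: (nu _) => [c| |]; [|by rewrite gt0_mulye|by rewrite gt0_mulNye].
rewrite -EFinM => -[bE]; congr EFin; apply: (mulIf (lt0r_neq0 b0)).
by rewrite mul1r -bE.
Qed.

Definition tuple_sub N P (e : 'I_P -> 'I_N) (t : N.-tuple RT) : P.-tuple RT :=
  [tuple tnth t (e j) | j < P].

Lemma measurable_tuple_sub N P (e : 'I_P -> 'I_N) : measurable_fun setT (tuple_sub e).
Proof.
apply/measurable_fun_tnthP => j.
rewrite (_ : _ \o _ = (@tnth N RT)^~ (e j)); first exact: measurable_tnth.
by apply/funext => t /=; rewrite tnth_mktuple.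
Qed.

(** * Factorization of Lebesgue measure along blocks of coordinates *)

Section blocks.
Variables (l N : nat) (P : 'I_l -> nat) (e : forall k, 'I_(P k) -> 'I_N).
Hypothesis e_bij : bijective (fun s : {k : 'I_l & 'I_(P k)} => e (tagged s)).

Let block (S : forall k, set ((P k).-tuple RT)) : set (N.-tuple RT) :=
  [set t | forall k, S k (tuple_sub (@e k) t)].

Let cube_bound (P : nat) (C : R) (A : set (P.-tuple RT)) :=
  forall t, A t -> forall i, `|tnth t i : R| <= C.

(** With the other blocks confined to their sets, the volume is a shift-invariant measure of the set
    allowed for block [k0], hence a multiple of Lebesgue measure; the factor is its value at the
    unit cube. The bound on the other blocks makes this measure sigma-finite. *)
Let block_swap (C : R) (S S' : forall k, set ((P k).-tuple RT)) (k0 : 'I_l) :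
  (forall k, measurable (S k)) -> (forall k, cube_bound C (S k)) ->
  (forall k, k != k0 -> S' k = S k) ->
  S' k0 = @unit_cube R (P k0) ->
  lam N (block S) = (lam N (block S') * lam (P k0) (S k0))%E.
Proof.
move=> mS bS S'S S'k0.
pose D : set (N.-tuple RT) := [set t | forall k, k != k0 -> S k (tuple_sub (@e k) t)].
have mD : measurable D.
  rewrite (_ : D = \bigcap_(k in [set k | k != k0]) (tuple_sub (@e k) @^-1` S k)).
    apply: fin_bigcap_measurable => [|k _].
      exact: finite_finset.
    by apply: (measurable_preimage _ (mS k)); exact: measurable_tuple_sub.
  by apply/seteqP; split=> t.
pose nu : {measure set ((P k0).-tuple RT) -> \bar R} :=
  measure_function_pushforward__canonical__measure_function_Measure
    (mrestr (lam N) mD) (measurable_tuple_sub (@e k0)).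
have nuE A : nu A = lam N ((tuple_sub (@e k0) @^-1` A) `&` D) by [].
have e_inj := bij_inj e_bij.
(* Padding by zeros turns a shift of block [k0] into a shift of the whole tuple that fixes the other
   blocks. *)
pose ext (s : (P k0).-tuple RT) : N.-tuple RT :=
  [tuple (\sum_(j < P k0) (tnth s j : R) *+ (e j == i)) : R | i < N].
have ext_sub s t : tuple_sub (@e k0) (tuple_add (ext s) t) = tuple_add s (tuple_sub (@e k0) t).
  apply: eq_from_tnth => j; rewrite !tnth_mktuple; congr (_ + _).
  rewrite (bigD1 j)//= eqxx mulr1n big1 ?addr0// => i ij.
  case: eqP => // eij; have := e_inj (existT _ k0 i) (existT _ _ j) eij.
  by move/eqP; rewrite eq_Tagged /= (negbTE ij).
have ext_sub0 s t k : k != k0 -> tuple_sub (@e k) (tuple_add (ext s) t) = tuple_sub (@e k) t.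
  move=> kk0; apply: eq_from_tnth => j; rewrite !tnth_mktuple big1 ?add0r// => i _.
  case: eqP => // eij; have := e_inj (existT _ k0 i) (existT _ _ j) eij.
  by move/(congr1 tag)/eqP; rewrite /= eq_sym (negbTE kk0).
have nu_shift s A : measurable A -> nu (tuple_add s @^-1` A) = nu A.
  move=> mA; rewrite !nuE -[RHS](lebesgue_power_shift (ext s)).
    congr (lam N _); apply/seteqP; split=> t [/= ta tD]; split => /=.
    - by rewrite ext_sub.
    - by move=> k kk0; rewrite ext_sub0//; exact: tD.
    - by rewrite -ext_sub.
    - by move=> k kk0; rewrite -(ext_sub0 s t k kk0); exact: tD.
  apply: measurableI => //; apply: (measurable_preimage _ mA).
  exact: measurable_tuple_sub.
have nu_sf : sigma_finite setT nu.
  exists (fun n => [set t | sqr_sum t <= n%:R]).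
    apply/seteqP; split=> t // _.
    exists (Num.truncn (sqr_sum t)).+1 => //=; apply/ltW/truncnS_gt.
  move=> n; split; first exact: measurable_sqr_sum_le.
  (* A coordinate in block [k0] has square at most [n], any other at most [C ^+ 2], and there are
     [N] of them. *)
  rewrite nuE; apply: (@lebesgue_power_bounded _ (N%:R * (n%:R + C ^+ 2))).
    apply: measurableI => //.
    apply: (measurable_preimage _ (@measurable_sqr_sum_le (P k0) n%:R)).
    exact: measurable_tuple_sub.
  move=> t [/= tn tD]; rewrite /sqr_sum.
  rewrite -[in leRHS](card_ord N) mulr_natl -sumr_const.
  apply: ler_sum => i _; have [g ge eg] := e_bij.
  rewrite -(eg i); case: (g i) => k j /=.
  case: (eqVneq k k0) => [kk0|kk0].
    subst k; apply: (@le_trans _ _ n%:R); last by rewrite lerDl sqr_ge0.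
    apply: le_trans tn; rewrite /sqr_sum (bigD1 j)//= tnth_mktuple lerDl.
    by apply: sumr_ge0 => ? _; exact: sqr_ge0.
  apply: (@le_trans _ _ (C ^+ 2)); last by rewrite lerDr ler0n.
  have := bS k _ (tD k kk0) j; rewrite tnth_mktuple => h.
  by rewrite -[leLHS]real_normK ?num_real// lerXn2r ?nnegrE// (le_trans _ h).
have := shift_invariant_measureE nu_sf nu_shift (mS k0).
rewrite !nuE => E.
have -> : block S = (tuple_sub (@e k0) @^-1` S k0) `&` D.
  apply/seteqP; split=> t /=; first by move=> h; split=> // k _; exact: h.
  by move=> [h1 h2] k; case: (eqVneq k k0) => [->//|]; exact: h2.
rewrite E; congr (lam N _ * _)%E.
apply/seteqP; split=> t /=.
  move=> [h1 h2] k; case: (eqVneq k k0) => [->|kk0]; first by rewrite S'k0.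
  by rewrite S'S//; exact: h2.
move=> h; split; first by rewrite -S'k0; exact: h.
by move=> k kk0; rewrite -S'S//; exact: h.
Qed.

Lemma lebesgue_power_block (C : R) (S : forall k, set ((P k).-tuple RT)) :
  (forall k, measurable (S k)) ->
  (forall k t, S k t -> forall i, `|tnth t i : R| <= C) ->
  lam N [set t | forall k, S k (tuple_sub (@e k) t)] =
  (\prod_(k < l) lam (P k) (S k))%E.
Proof.
move=> mS bS.
(* The blocks are exchanged one at a time: the first [j] carry [S], the others the unit cube. The
   common bound must also cover the cube, whence the maximum with 1. *)
pose F j (k : 'I_l) := if (k < j)%N then S k else @unit_cube R (P k).
have mF j k : measurable (F j k).
  by rewrite /F; case: ifP => // _; exact: measurable_unit_cube.
have bF j k : cube_bound (Num.max C 1) (F j k).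
  rewrite /F; case: ifP => // _ t h i; rewrite le_max.
    by rewrite (bS k).
  have := h i; rewrite in_itv /= => /andP[h0 h1].
  by rewrite ger0_norm// h1 orbT.
suff H j : (j <= l)%N ->
    lam N (block (F j)) = (\prod_(k < l | (k < j)%N) lam (P k) (S k))%E.
  have := H l (leqnn l); rewrite (eq_bigl xpredT); last first.
    by move=> k; rewrite ltn_ord.
  move=> <-; congr (lam N _); apply/seteqP; split=> t h k; have := h k;
    by rewrite /F ltn_ord.
elim: j => [|j ih] jl.
  rewrite big_pred0_eq -(lebesgue_power_unit_cube N).
  congr (lam N _); apply/seteqP; split=> t.
    move=> h i; have [g ge eg] := e_bij.
    rewrite -(eg i); case: (g i) => k m /=.
    by have := h k; rewrite /F ltn0 => /(_ m); rewrite tnth_mktuple.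
  by move=> h k; rewrite /F ltn0 => i; rewrite tnth_mktuple; exact: h.
rewrite (@block_swap (Num.max C 1) (F j.+1) (F j) (Ordinal jl))//; first last.
- by rewrite /F /= ltnn.
- move=> k kj; rewrite /F ltnS [in RHS]leq_eqVlt.
  by rewrite (negbTE (kj : (k : nat) != j)).
rewrite ih; last exact: ltnW.
rewrite [RHS](bigD1 (Ordinal jl)); last exact: ltnSn.
rewrite [RHS]muleC {1}/F [(Ordinal jl < j.+1)%N]ltnSn.
by congr mule; apply: eq_bigl => k; rewrite ltn_neqAle andbC.
Qed.

End blocks.

End lebesgue_power_uniqueness.

(** * Hermitian matrices and microstates *)

Section complex_matrices.
Context {R : realType}.
Local Notation C := R[i].
Local Notation Re := (@complex.Re R).
Local Notation Im := (@complex.Im R).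

Lemma complex_ReD (x y : C) : Re (x + y) = Re x + Re y. Proof. by case: x y => ? ? []. Qed.
Lemma complex_ImD (x y : C) : Im (x + y) = Im x + Im y. Proof. by case: x y => ? ? []. Qed.
Lemma complex_ReM (x y : C) : Re (x * y) = Re x * Re y - Im x * Im y.
Proof. by case: x y => ? ? []. Qed.
Lemma complex_ImM (x y : C) : Im (x * y) = Re x * Im y + Im x * Re y.
Proof. by case: x y => ? ? []. Qed.
Lemma complex_Re_conj (x : C) : Re (Num.conj x) = Re x.
Proof. by rewrite -[Num.conj x]/(conjc x); case: x. Qed.
Lemma complex_Im_conj (x : C) : Im (Num.conj x) = - Im x.
Proof. by rewrite -[Num.conj x]/(conjc x); case: x. Qed.
Lemma complex_Re_sum I (r : seq I) (P : pred I) (F : I -> C) :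
  Re (\sum_(i <- r | P i) F i) = \sum_(i <- r | P i) Re (F i).
Proof. exact: (big_morph _ complex_ReD erefl). Qed.
Lemma complex_Im_sum I (r : seq I) (P : pred I) (F : I -> C) :
  Im (\sum_(i <- r | P i) F i) = \sum_(i <- r | P i) Im (F i).
Proof. exact: (big_morph _ complex_ImD erefl). Qed.

Lemma sqr_normcE (z : C) : Normc.normc z ^+ 2 = Re z ^+ 2 + Im z ^+ 2.
Proof. by case: z => a b; rewrite /= sqr_sqrtr// addr_ge0// sqr_ge0. Qed.

(** The square of [l2norm]: norm inequalities become polynomial in the real and imaginary parts of
    the entries, which suits both limits and measurability. *)
Definition l2sq d (v : 'cV[C]_d) : R := \sum_i Normc.normc (v i 0) ^+ 2.

Lemma l2sq_ge0 d (v : 'cV[C]_d) : 0 <= l2sq v.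
Proof. by apply: sumr_ge0 => i _; rewrite sqr_ge0. Qed.

Lemma l2sqE d (v : 'cV[C]_d) : (l2sq v)%:C = (v ^t* *m v) 0 0.
Proof.
rewrite mxE /l2sq rmorph_sum; apply: eq_bigr => i _.
rewrite !mxE sqr_normcE -[Num.conj _]/(conjc _).
by case: (v i 0) => a b; apply/eqP; rewrite eq_complex /=; apply/andP; split; apply/eqP; ring.
Qed.

Lemma l2sqZ d (a : R) (v : 'cV[C]_d) : l2sq (a%:C *: v) = a ^+ 2 * l2sq v.
Proof.
rewrite /l2sq mulr_sumr; apply: eq_bigr => i _.
by rewrite mxE Normc.normcM exprMn /= expr0n addr0 sqrtr_sqr real_normK ?num_real.
Qed.

Lemma l2sq_eq0 d (v : 'cV[C]_d) : l2sq v = 0 -> v = 0.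
Proof.
move/psumr_eq0P => h; apply/colP => i; rewrite mxE; apply: Normc.eq0_normc.
by apply/eqP; rewrite -sqrf_eq0 h// => ? _; rewrite sqr_ge0.
Qed.

Lemma normc_ge0 (z : C) : 0 <= Normc.normc z.
Proof. by case: z => a b; rewrite /= sqrtr_ge0. Qed.

Lemma normc_sum_le I (r : seq I) (P : pred I) (F : I -> C) :
  Normc.normc (\sum_(i <- r | P i) F i) <= \sum_(i <- r | P i) Normc.normc (F i).
Proof.
elim/big_ind2 : _ => //; first by rewrite Normc.normc0.
by move=> x a y b xa yb; rewrite (le_trans (le_normcD _ _))// lerD.
Qed.

Lemma l2norm_le1 d (v : 'cV[C]_d) : (l2norm v <= 1) = (l2sq v <= 1).
Proof.
by rewrite /l2norm -[in LHS](@sqrtr1 R) ler_sqrt.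
Qed.

(** [sup] is a least upper bound once the set is known to be nonempty and bounded. The entries of
    [v] have modulus at most 1, so the sums of the moduli along the rows of [A] bound the entries of
    [A *m v]. *)
Lemma has_sup_opnorm d (A : 'M[C]_d) :
  has_sup [set l2norm (A *m v) | v in [set v : 'cV[C]_d | l2norm v <= 1]].
Proof.
split.
  exists (l2norm (A *m 0)), 0 => //=.
  rewrite l2norm_le1 /l2sq big1// => i _.
  by rewrite mxE Normc.normc0 expr0n.
exists (Num.sqrt (\sum_i (\sum_j Normc.normc (A i j)) ^+ 2)) => _ [v /= v1 <-].
rewrite l2norm_le1 in v1.
apply: ler_wsqrtr; apply: ler_sum => i _; rewrite mxE.
apply: lerXn2r; rewrite ?nnegrE ?normc_ge0//.
  by apply: sumr_ge0 => j _; exact: normc_ge0.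
apply: le_trans (normc_sum_le _ _ _) _; apply: ler_sum => j _.
rewrite Normc.normcM ler_piMr ?normc_ge0// -(expr_le1 (n := 2))// ?normc_ge0//.
apply: le_trans v1; rewrite /l2sq (bigD1 j)//= lerDl.
by apply: sumr_ge0 => ? _; rewrite sqr_ge0.
Qed.

Lemma opnorm_leP d (A : 'M[C]_d) (r : R) : 0 <= r ->
  opnorm A <= r <-> forall v, l2sq (A *m v) <= r ^+ 2 * l2sq v.
Proof.
move=> r0; split=> [Ar v|Ar].
  have [/l2sq_eq0 ->|v0] := eqVneq (l2sq v) 0.
    rewrite mulmx0 (_ : l2sq 0 = 0) ?mulr0// /l2sq big1// => i _.
    by rewrite mxE Normc.normc0 expr0n.
  have vp : 0 < l2sq v by rewrite lt0r v0 l2sq_ge0.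
  pose a := (Num.sqrt (l2sq v))^-1.
  have a2 : a ^+ 2 = (l2sq v)^-1 by rewrite exprVn sqr_sqrtr// ltW.
  have : l2norm (A *m (a%:C *: v)) <= r.
    apply: le_trans Ar; apply: ub_le_sup; first exact: (has_sup_opnorm A).2.
    by exists (a%:C *: v) => //=; rewrite l2norm_le1 l2sqZ a2 mulVf.
  rewrite -scalemxAr /l2norm -[\sum_i _]/(l2sq (_ *: _)) l2sqZ a2 => h.
  rewrite -ler_pdivrMr// mulrC.
  rewrite -[leLHS]sqr_sqrtr ?lerXn2r ?nnegrE ?sqrtr_ge0//.
  by rewrite mulr_ge0 ?invr_ge0 ?l2sq_ge0.
apply: ge_sup; first exact: (has_sup_opnorm A).1.
move=> _ [v /= v1 <-]; rewrite l2norm_le1 in v1.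
rewrite /l2norm -[\sum_i _]/(l2sq _) -[leRHS]ger0_norm// -sqrtr_sqr.
apply: ler_wsqrtr; apply: le_trans (Ar v) _.
by rewrite ler_piMr// sqr_ge0.
Qed.

Lemma l2sq_unitary d (U : 'M[C]_d) (v : 'cV[C]_d) : U \is unitarymx ->
  l2sq (U *m v) = l2sq v.
Proof.
move=> Uu; apply: complexI; rewrite !l2sqE trmx_mul map_mxM /= mulmxA.
by rewrite -(mulmxA _ (U ^t*)) (mulmx1C (unitarymxP Uu)) mulmx1.
Qed.

(** The bound for the conjugate is applied to [U ^t* *m v], and unitaries preserve the norm. The
    direction is the one needed to pass from conjugated microstates back to the original
    matrices. *)
Lemma opnorm_conj d (U A : 'M[C]_d) (r : R) : 0 <= r -> U \is unitarymx ->
  opnorm (U ^t* *m A *m U) <= r -> opnorm A <= r.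
Proof.
move=> r0 Uu /(opnorm_leP _ r0) h; apply/opnorm_leP => // v.
have := h (U ^t* *m v).
rewrite !mulmxA -(mulmxA _ U) (unitarymxP Uu) mulmx1 -mulmxA.
have Uu' : U ^t* \is unitarymx by rewrite trmxC_unitary.
by rewrite !(l2sq_unitary _ Uu').
Qed.

Definition int_vec d (w : {ffun 'I_d -> int * int}) : 'cV[C]_d :=
  \col_i ((w i).1%:~R +i* (w i).2%:~R).

Lemma l2sq_mulmxE d (A : 'M[C]_d) (v : 'cV[C]_d) : l2sq (A *m v) = \sum_i
  ((\sum_j (Re (A i j) * Re (v j 0) - Im (A i j) * Im (v j 0))) ^+ 2 +
   (\sum_j (Re (A i j) * Im (v j 0) + Im (A i j) * Re (v j 0))) ^+ 2).
Proof.
apply: eq_bigr => i _; rewrite sqr_normcE mxE complex_Re_sum complex_Im_sum.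
by congr (_ ^+ 2 + _ ^+ 2); apply: eq_bigr => j _; rewrite ?complex_ReM ?complex_ImM.
Qed.

Lemma cvg_floor_div (x : R) :
  (fun n => (n.+1%:R)^-1 * (Num.floor (n.+1%:R * x))%:~R : R) @ \oo --> x.
Proof.
apply: (@squeeze_cvgr _ _ _ _ (fun n => x - (n.+1%:R)^-1) (cst x)).
- near=> n.
  have n0 : (0 : R) < n.+1%:R by [].
  apply/andP; split.
    rewrite -(ler_pM2l n0) mulrA divff ?gt_eqF// mul1r mulrBr divff ?gt_eqF//.
    by rewrite lerBlDr ltW// -intrD1 lt_succ_floor.
  by rewrite ler_pdivrMl// ge_floor.
- rewrite -[X in _ --> X]subr0; apply: cvgB; first exact: cvg_cst.
  exact: cvg_harmonic.
- exact: cvg_cst.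
Unshelve. all: by end_near. Qed.

Lemma cvg_sum (I : finType) (f : I -> nat -> R) (a : I -> R) :
  (forall i, f i @ \oo --> a i) ->
  (fun n => \sum_i f i n) @ \oo --> \sum_i a i.
Proof.
by move=> fa; apply: cvg_big => //; exact: add_continuous.
Qed.

Lemma cvg_l2sq_mulmx d (A : 'M[C]_d) (u : nat -> 'cV[C]_d) (v : 'cV[C]_d) :
  (forall i, (fun n => Re (u n i 0)) @ \oo --> Re (v i 0)) ->
  (forall i, (fun n => Im (u n i 0)) @ \oo --> Im (v i 0)) ->
  (fun n => l2sq (A *m u n)) @ \oo --> l2sq (A *m v).
Proof.
move=> ur ui; rewrite l2sq_mulmxE.
rewrite (_ : (fun n => _) = (fun n => \sum_i
  ((\sum_j (Re (A i j) * Re (u n j 0) - Im (A i j) * Im (u n j 0))) ^+ 2 +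
   (\sum_j (Re (A i j) * Im (u n j 0) + Im (A i j) * Re (u n j 0))) ^+ 2))); last first.
  by apply/funext => n; exact: l2sq_mulmxE.
apply: cvg_sum => i; apply: cvgD; rewrite expr2;
  under eq_fun do rewrite expr2.
  by apply: cvgM; apply: cvg_sum => j; apply: cvgB;
    apply: cvgM => //; exact: cvg_cst.
by apply: cvgM; apply: cvg_sum => j; apply: cvgD;
    apply: cvgM => //; exact: cvg_cst.
Qed.

(* Both sides are homogeneous in [v] and the complex rational vectors are
   dense, hence vectors of Gaussian integers suffice. *)
Lemma opnorm_le_intP d (A : 'M[C]_d) (r : R) : 0 <= r ->
  opnorm A <= r <->
  forall w, l2sq (A *m int_vec w) <= r ^+ 2 * l2sq (int_vec w).
Proof.
move=> r0; split=> [/(opnorm_leP _ r0) h w|h]; first exact: h.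
apply/opnorm_leP => // v.
pose w n : {ffun 'I_d -> int * int} := [ffun i =>
  (Num.floor (n.+1%:R * Re (v i 0)), Num.floor (n.+1%:R * Im (v i 0)))].
pose u n := ((n.+1%:R)^-1)%:C *: int_vec (w n).
have ur i : (fun n => Re (u n i 0)) @ \oo --> Re (v i 0).
  under eq_fun do rewrite !mxE ffunE complex_ReM /= mul0r subr0.
  exact: cvg_floor_div.
have ui i : (fun n => Im (u n i 0)) @ \oo --> Im (v i 0).
  under eq_fun do rewrite !mxE ffunE complex_ImM /= mul0r addr0.
  exact: cvg_floor_div.
have cA := cvg_l2sq_mulmx (A := A) ur ui.
(* With the identity matrix the same convergence statement gives the right-hand side. *)
have c1 := cvg_l2sq_mulmx (A := 1%:M) ur ui.
rewrite mul1mx in c1.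
apply: (ler_cvg_to cA); first by apply: (@cvgM _ _ _ _ (cst (r ^+ 2))); [exact: cvg_cst|exact: c1].
apply: nearW => n /=; rewrite mul1mx /u -scalemxAr !l2sqZ mulrCA.
by rewrite ler_wpM2l ?sqr_ge0.
Qed.

Lemma samx_herm d (A : samx R d) i j : Num.conj (A i j) = A j i.
Proof. by rewrite -[in RHS](eqP (samxP A)) !mxE. Qed.

(** The inverse of [samx_coord]: positions above the diagonal hold real parts, positions below it
    the imaginary parts of the mirrored entries. It takes an arbitrary matrix, so it applies
    directly to a product such as [V ^t* *m A *m V]. *)
Definition samx_coords d (A : 'M[C]_d) (i j : 'I_d) : R :=
  if i == j then Re (A i i)
  else if (i < j)%N then Num.sqrt 2 * Re (A i j) else Num.sqrt 2 * Im (A j i).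

Let sqrt2K (x : R) : Num.sqrt 2 * x / Num.sqrt 2 = x.
Proof. by rewrite mulrAC divff ?mul1r// sqrtr_eq0 -ltNge. Qed.

Let sqrt2Kr (x : R) : Num.sqrt 2 * (x / Num.sqrt 2) = x.
Proof. by rewrite mulrCA divff ?mulr1// sqrtr_eq0 -ltNge. Qed.

Lemma samx_coordsK d (A : samx R d) : samx_coord (samx_coords A) = A.
Proof.
apply/val_inj/matrixP => i j /=; rewrite mxE /samx_coords eqxx.
have [->|ij] := eqVneq i j.
  have := samx_herm A j j; rewrite -[Num.conj _]/(conjc _).
  case: (A j j) => a b [] /eqP; rewrite eqNr => /eqP ->; exact: complexr0.
have [h|h|/val_inj h] := ltngtP i j.
- by rewrite !sqrt2K; case: (A i j).
- rewrite !sqrt2K -(samx_herm A j i) -[Num.conj _]/(conjc _).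
  by case: (A j i).
- by rewrite h eqxx in ij.
Qed.

Lemma samx_coordK d (x : 'I_d -> 'I_d -> R) i j :
  samx_coords (samx_coord x) i j = x i j.
Proof.
rewrite /samx_coords /= !mxE eqxx.
have [->//|ij] := eqVneq i j.
have [h|h|/val_inj h] := ltngtP i j.
- by rewrite /= sqrt2Kr.
- by rewrite /= sqrt2Kr.
- by rewrite h eqxx in ij.
Qed.

Lemma samx_coord_mxD d (x y : 'I_d -> 'I_d -> R) :
  samx_coord_mx (fun i j => x i j + y i j) = samx_coord_mx x + samx_coord_mx y.
Proof.
apply/matrixP => i j; rewrite !mxE; case: ifP => _; first by rewrite rmorphD.
by case: ifP => _; apply/eqP; rewrite eq_complex /=; apply/andP; split; apply/eqP; ring.
Qed.

(** For a self-adjoint matrix the trace of the square is the sum of the squared norms of the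
    columns, and each column is the image of a unit vector. *)
Lemma mxtrace_sqr_le d (A : samx R d) (r : R) : 0 <= r -> opnorm A <= r ->
  Re (\tr (A *m A)) <= d%:R * r ^+ 2.
Proof.
move=> r0 /(opnorm_leP _ r0) Ar.
rewrite complex_Re_sum -[in leRHS](card_ord d) mulr_natl -sumr_const.
apply: ler_sum => j _.
have e1 : l2sq (delta_mx j 0 : 'cV[C]_d) = 1.
  rewrite /l2sq (bigD1 j)//= mxE !eqxx Normc.normc1 expr1n big1 ?addr0// => i ij.
  by rewrite mxE (negbTE ij) Normc.normc0 expr0n.
have := Ar (delta_mx j 0); rewrite e1 mulr1; apply: le_trans.
rewrite -colE /l2sq mxE complex_Re_sum; apply: ler_sum => i _.
rewrite mxE -(samx_herm A i j) complex_ReM complex_Re_conj complex_Im_conj sqr_normcE.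
by rewrite mulNr opprK !expr2.
Qed.

(** * Families of self-adjoint matrices as real coordinate tuples *)

Section family.
Variables (d : nat) (K : finType).
Local Notation RT := (measurableTypeR R).
Local Notation N := #|{: K * 'I_d * 'I_d}|.
Local Notation coord := (@samx_family_coord R d K).

Definition samx_family_tuple (F : K -> samx R d) : N.-tuple RT :=
  [tuple (let x := enum_val i in samx_coords (F x.1.1) x.1.2 x.2) : R | i < N].

Lemma samx_family_tupleK F : coord (samx_family_tuple F) = F.
Proof.
apply/funext => k; rewrite /samx_family_coord -[RHS]samx_coordsK.
congr samx_coord; apply/funext => i; apply/funext => j.
by rewrite tnth_mktuple enum_rankK.
Qed.

Lemma samx_family_coordK t : samx_family_tuple (coord t) = t.
Proof.
apply: eq_from_tnth => i; rewrite tnth_mktuple /= samx_coordK.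
by rewrite -!surjective_pairing enum_valK.
Qed.

Lemma samx_family_coordD (s t : N.-tuple RT) k :
  (coord (tuple_add s t) k : 'M[R[i]]_d) = (coord s k : 'M[R[i]]_d) + coord t k.
Proof.
rewrite /samx_family_coord /= -samx_coord_mxD; congr samx_coord_mx.
by apply/funext => i; apply/funext => j; rewrite tnth_mktuple.
Qed.

(** Orthonormality of the coordinates. It makes conjugation a Euclidean isometry and turns operator
    norm bounds into bounds on tuples. *)
Lemma sqr_sum_trace t : sqr_sum t = \sum_k Re (\tr (coord t k *m coord t k)).
Proof.
rewrite /sqr_sum (reindex (@enum_rank {: K * 'I_d * 'I_d})) /=; last first.
  exact/onW_bij/enum_rank_bij.
rewrite (eq_bigr (fun p : K * 'I_d * 'I_d =>
  (fun k i j => (tnth t (enum_rank (k, i, j)) : R) ^+ 2) p.1.1 p.1.2 p.2)); last first.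
  by move=> [[k i] j] _.
rewrite -(pair_bigA _ (fun p j => (tnth t (enum_rank (p.1, p.2, j)) : R) ^+ 2)) /=.
rewrite -(pair_bigA _ (fun k i => \sum_j (tnth t (enum_rank (k, i, j)) : R) ^+ 2)) /=.
apply: eq_bigr => k _; rewrite samx_coord_isometry /=.
by apply: eq_bigr => i _; apply: eq_bigr => j _; rewrite expr2.
Qed.

Definition family_conj (U : K -> unitary_group R d) (F : K -> samx R d) :
  samx_family R d K := fun k => unitary_conj (U k) (F k).

Definition conj_tuple U (t : N.-tuple RT) : N.-tuple RT :=
  samx_family_tuple (family_conj U (coord t)).

Lemma conj_tupleE U t : coord (conj_tuple U t) = family_conj U (coord t).
Proof. exact: samx_family_tupleK. Qed.

Lemma conj_tupleD U s t :
  conj_tuple U (tuple_add s t) = tuple_add (conj_tuple U s) (conj_tuple U t).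
Proof.
apply: (can_inj samx_family_coordK); apply/funext => k; apply/val_inj.
have E t' : val (coord (conj_tuple U t') k) = (U k) ^t* *m coord t' k *m U k.
  by rewrite conj_tupleE.
apply: (etrans (E _)); apply: (etrans _ (esym (samx_family_coordD _ _ k))).
apply: (etrans _ (esym (congr2 +%R (E s) (E t)))).
by rewrite samx_family_coordD mulmxDr mulmxDl.
Qed.

Lemma sqr_sum_conj_tuple U t : sqr_sum (conj_tuple U t) = sqr_sum t.
Proof.
rewrite !sqr_sum_trace; apply: eq_bigr => k _; congr Re.
rewrite conj_tupleE /=.
rewrite !mulmxA -(mulmxA _ (U k : 'M[R[i]]_d)) (unitarymxP (unitaryP _)) mulmx1.
by rewrite mxtrace_mulC !mulmxA (unitarymxP (unitaryP _)) mul1mx.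
Qed.

End family.

Definition unitary_adj d (U : unitary_group R d) : unitary_group R d.
Proof. by exists (U ^t*); rewrite trmxC_unitary; exact: unitaryP. Defined.

Lemma conj_tupleK d (K : finType) (U : K -> unitary_group R d) :
  cancel (conj_tuple (fun k => unitary_adj (U k))) (conj_tuple U).
Proof.
move=> t; rewrite /conj_tuple samx_family_tupleK -[RHS]samx_family_coordK.
congr samx_family_tuple; apply/funext => k; apply/val_inj => /=.
rewrite trmxCK !mulmxA (mulmx1C (unitarymxP (unitaryP _))) mul1mx.
by rewrite -mulmxA (mulmx1C (unitarymxP (unitaryP _))) mulmx1.
Qed.

Lemma prod_unitary_conj d (U : unitary_group R d) (I : Type) (s : seq I)
    (F : I -> samx R d) :
  \prod_(i <- s) (unitary_conj U (F i) : 'M[R[i]]_d) =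
  U ^t* *m (\prod_(i <- s) (F i : 'M[R[i]]_d)) *m U.
Proof.
elim: s => [|i s ih]; first by rewrite !big_nil mulmx1 (mulmx1C (unitarymxP (unitaryP _))).
rewrite !big_cons ih -!mulmxE !mulmxA -(mulmxA _ (U : 'M[R[i]]_d)).
by rewrite (unitarymxP (unitaryP _)) mulmx1.
Qed.

Lemma ntrace_unitary_conj d (U : unitary_group R d) (A : 'M[C]_d) :
  ntrace (U ^t* *m A *m U) = ntrace A.
Proof.
by rewrite /ntrace mxtrace_mulC mulmxA (unitarymxP (unitaryP _)) mul1mx.
Qed.

End complex_matrices.

(** * From joint microstates to the microstates of each family *)

Section microstates_theory.
Context (R : realType) (A : cstar_algebra R) (phi : cstar_state A).
Variables (l : nat) (n m : 'I_l -> nat).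
Variables (X : forall k, 'I_(n k) -> A) (Y : forall k, 'I_(m k) -> A).

Definition joint_index := ({k : 'I_l & 'I_(n k)} + {k : 'I_l & 'I_(m k)})%type.

(** Written as the match inside [orbital_map], so that conjugation by colors and [orbital_map] are
    convertible. *)
Definition color (t : joint_index) : 'I_l :=
  match t with inl s => tag s | inr s => tag s end.

Definition family_index (k : 'I_l) (t : ('I_(n k) + 'I_(m k))%type) : joint_index :=
  match t with inl i => inl (existT _ k i) | inr j => inr (existT _ k j) end.

Lemma color_family_index k t : color (@family_index k t) = k.
Proof. by case: t. Qed.

(** A word in the variables of family [k] is a word in the joint variables, and all its letters are
    conjugated by the same [U k], which cancels between letters and then under the trace. *)
Lemma microstates_family (r : R) M d (eps : R) (U : 'I_l -> unitary_group R d)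
    (F : samx_family R d joint_index) : 0 <= r ->
  microstates phi (joint_family X) (joint_family Y) r M d eps
    (family_conj (fun t => U (color t)) F) ->
  forall k, microstates phi (@X k) (@Y k) r M d eps (fun t => F (@family_index k t)).
Proof.
move=> r0 [hop htr] k; split=> [t|p q pq].
  apply: (opnorm_conj r0 (unitaryP (U k))).
  by have := hop (family_index t); rewrite /family_conj color_family_index.
have := htr (map (existT _ k) p) (map (existT _ k) q).
rewrite !size_map -map_rev !big_map => /(_ pq).
rewrite /joint_family /family_conj /= !(prod_unitary_conj (U k)).
rewrite -mulmxE !mulmxA -(mulmxA _ (U k : 'M[R[i]]_d)) (unitarymxP (unitaryP _)) mulmx1.
by rewrite -[X in ntrace (X *m _)]mulmxA ntrace_unitary_conj.
Qed.

Lemma microstates_sqr_sum (I J : finType) (x : I -> A) (y : J -> A)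
    (r : R) M d (eps : R) t : 0 <= r ->
  microstates phi x y r M d eps (@samx_family_coord R d _ t) ->
  sqr_sum t <= #|{: I + J}|%:R * (d%:R * r ^+ 2).
Proof.
move=> r0 [hop _]; rewrite sqr_sum_trace mulr_natl -sumr_const.
by apply: ler_sum => k _; apply: mxtrace_sqr_le => //; exact: hop.
Qed.

End microstates_theory.

(** * Measurability of the microstate spaces *)

Section complex_measurability.
Context {R : realType}.
Local Notation C := R[i].
Local Notation Re := (@complex.Re R).
Local Notation Im := (@complex.Im R).
Context d0 (W : measurableType d0).

Definition cmeasurable (f : W -> C) :=
  measurable_fun setT (fun w => Re (f w)) /\
  measurable_fun setT (fun w => Im (f w)).

Lemma cmeasurable_cst (c : C) : cmeasurable (fun=> c).
Proof. by split; exact: measurable_cst. Qed.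

Lemma cmeasurableD f g : cmeasurable f -> cmeasurable g ->
  cmeasurable (fun w => f w + g w).
Proof.
move=> [fr fi] [gr gi]; split.
  by under eq_fun do rewrite complex_ReD; exact: measurable_funD.
by under eq_fun do rewrite complex_ImD; exact: measurable_funD.
Qed.

Lemma cmeasurableM f g : cmeasurable f -> cmeasurable g ->
  cmeasurable (fun w => f w * g w).
Proof.
move=> [fr fi] [gr gi]; split.
  under eq_fun do rewrite complex_ReM.
  by apply: measurable_funB; exact: measurable_funM.
under eq_fun do rewrite complex_ImM.
by apply: measurable_funD; exact: measurable_funM.
Qed.

Lemma cmeasurable_conj f : cmeasurable f -> cmeasurable (fun w => Num.conj (f w)).
Proof.
move=> [fr fi]; split; first by under eq_fun do rewrite complex_Re_conj.
under eq_fun do rewrite complex_Im_conj.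
exact: measurableT_comp.
Qed.

Lemma cmeasurable_sum (I : Type) (s : seq I) (f : I -> W -> C) :
  (forall i, cmeasurable (f i)) -> cmeasurable (fun w => \sum_(i <- s) f i w).
Proof.
move=> mf; split.
  by under eq_fun do rewrite complex_Re_sum; apply: measurable_sum => i; exact: (mf i).1.
by under eq_fun do rewrite complex_Im_sum; apply: measurable_sum => i; exact: (mf i).2.
Qed.

Lemma measurable_sqr_normc f : cmeasurable f ->
  measurable_fun setT (fun w => Normc.normc (f w) ^+ 2).
Proof.
move=> [fr fi]; under eq_fun do rewrite sqr_normcE.
by apply: measurable_funD; exact: measurable_funX.
Qed.

Lemma measurable_normc_lt f (eps : R) : cmeasurable f ->
  measurable [set w | Normc.normc (f w) < eps].
Proof.
move=> mf; have [e0|e0] := leP eps 0.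
  rewrite (_ : [set _ | _] = set0)//; apply/seteqP; split=> w //=.
  by rewrite ltNge (le_trans e0)// normc_ge0.
rewrite (_ : [set w | _] =
    (fun w => Normc.normc (f w) ^+ 2) @^-1` `]-oo, eps ^+ 2[%classic).
  by apply: measurable_preimage => //; exact: measurable_sqr_normc.
by apply/seteqP; split=> w /=;
  rewrite in_itv /= ltr_pXn2r// ?nnegrE ?normc_ge0 ?(ltW e0).
Qed.

Definition mxmeasurable p q (F : W -> 'M[C]_(p, q)) :=
  forall i j, cmeasurable (fun w => F w i j).

Lemma mxmeasurable_cst p q (A : 'M[C]_(p, q)) : mxmeasurable (fun=> A).
Proof. by move=> i j; exact: cmeasurable_cst. Qed.

Lemma mxmeasurableM p q s (F : W -> 'M[C]_(p, q)) (G : W -> 'M[C]_(q, s)) :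
  mxmeasurable F -> mxmeasurable G -> mxmeasurable (fun w => F w *m G w).
Proof.
move=> mF mG i j; under eq_fun do rewrite mxE.
by apply: cmeasurable_sum => k; exact: cmeasurableM.
Qed.

Lemma mxmeasurable_adj p q (F : W -> 'M[C]_(p, q)) :
  mxmeasurable F -> mxmeasurable (fun w => (F w) ^t*).
Proof. by move=> mF i j; under eq_fun do rewrite !mxE; exact: cmeasurable_conj. Qed.

Lemma mxmeasurable_prod p (I : Type) (s : seq I) (F : I -> W -> 'M[C]_p) :
  (forall i, mxmeasurable (F i)) -> mxmeasurable (fun w => \prod_(i <- s) F i w).
Proof.
move=> mF; elim: s => [|i s ih].
  by under eq_fun do rewrite big_nil; exact: mxmeasurable_cst.
by under eq_fun do rewrite big_cons -mulmxE; exact: mxmeasurableM.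
Qed.

Lemma measurable_l2sq p (v : W -> 'cV[C]_p) : mxmeasurable v ->
  measurable_fun setT (fun w => l2sq (v w)).
Proof.
by move=> mv; apply: measurable_sum => i; exact: measurable_sqr_normc.
Qed.

Lemma measurable_opnorm_le p (F : W -> 'M[C]_p) (r : R) : 0 <= r ->
  mxmeasurable F -> measurable [set w | opnorm (F w) <= r].
Proof.
move=> r0 mF.
rewrite (_ : [set w | _] = ~` \bigcup_(x : {ffun 'I_p -> int * int})
    [set w | r ^+ 2 * l2sq (int_vec x) < l2sq (F w *m int_vec x)]).
  apply: measurableC; apply: countable_bigcupT_measurable => // x.
  rewrite (_ : [set w | _] = (fun w => l2sq (F w *m int_vec x)) @^-1`
      `]r ^+ 2 * l2sq (int_vec x), +oo[%classic).
    apply: measurable_preimage => //; apply: measurable_l2sq.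
    by apply: mxmeasurableM => //; exact: mxmeasurable_cst.
  by apply/seteqP; split=> w /=; rewrite in_itv /= andbT.
apply/seteqP; split=> w /=.
  by move=> /(opnorm_le_intP _ r0) h [x _ /=]; rewrite ltNge h.
move=> h; apply/opnorm_le_intP => // x; rewrite leNgt; apply/negP => hx.
by apply: h; exists x.
Qed.

Lemma measurable_microstates (A : cstar_algebra R) (phi : cstar_state A)
    (I J : finType) (X : I -> A) (Y : J -> A) (r : R) M d (eps : R)
    (F : W -> samx_family R d (I + J)%type) : 0 <= r ->
  (forall k, mxmeasurable (fun w => F w k : 'M[C]_d)) ->
  measurable (F @^-1` microstates phi X Y r M d eps).
Proof.
move=> r0 mF.
pose E (pq : seq I * seq J) w :=
  phi ((\prod_(i <- pq.1) X i) * (\prod_(j <- pq.2) Y j))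
  - ntrace ((\prod_(i <- pq.1) (F w (inl i) : 'M[R[i]]_d))
            * (\prod_(j <- rev pq.2) (F w (inr j) : 'M[R[i]]_d))).
have mE pq : cmeasurable (E pq).
  apply: cmeasurableD; first exact: cmeasurable_cst.
  under eq_fun do rewrite -mulN1r.
  apply: cmeasurableM; first exact: cmeasurable_cst.
  apply: cmeasurableM; first exact: cmeasurable_cst.
  apply: cmeasurable_sum => i.
  rewrite -[fun w => _]/(fun w => ((\prod_(i <- pq.1) (F w (inl i) : 'M[R[i]]_d))
            *m (\prod_(j <- rev pq.2) (F w (inr j) : 'M[R[i]]_d))) i i).
  by apply: mxmeasurableM; apply: mxmeasurable_prod => k; exact: mF.
(* The set where the word [pq] violates its inequality. It is empty for words outside the length
   limits, so the union runs over the countable type of all pairs of words. *)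
pose B (pq : seq I * seq J) :=
  if (1 <= size pq.1 + size pq.2 <= M)%N then [set w | ~ Normc.normc (E pq w) < eps]
  else set0.
rewrite (_ : _ @^-1` _ = \bigcap_(k : I + J) [set w | opnorm (F w k) <= r] `&`
    ~` \bigcup_(pq : seq I * seq J) B pq).
  apply: measurableI.
    apply: fin_bigcap_measurable => // k _.
    by apply: measurable_opnorm_le => //; exact: mF.
  apply: measurableC; apply: countable_bigcupT_measurable => // pq.
  rewrite /B; case: ifP => // _.
  by apply: measurableC; exact: measurable_normc_lt.
apply/seteqP; split=> w /=.
  move=> [h1 h2]; split; first by move=> k _; exact: h1.
  by move=> [[p q] _]; rewrite /B /=; case: ifP => // pq; apply; exact: h2.
move=> [h1 h2]; split; first by move=> k; exact: h1.
move=> p q pq; apply: contrapT => h; apply: h2.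
by exists (p, q) => //; rewrite /B pq.
Qed.

End complex_measurability.

Section coordinates_measurability.
Context {R : realType}.
Local Notation C := R[i].
Local Notation Re := (@complex.Re R).
Local Notation Im := (@complex.Im R).

Lemma mxmeasurable_samx_family_coord d0 (W : measurableType d0) d (K : finType)
    (f : W -> #|{: K * 'I_d * 'I_d}|.-tuple (measurableTypeR R)) k :
  measurable_fun setT f ->
  mxmeasurable (fun w => samx_family_coord (f w) k : 'M[C]_d).
Proof.
move=> mf i j.
have mt x : measurable_fun setT (fun w => tnth (f w) x : R).
  by move/measurable_fun_tnthP : mf => /(_ x).
split; under eq_fun do rewrite mxE.
  case: (i == j) => /=; first exact: mt.
  by case: (i < j)%N => /=; apply: measurable_funM => //; exact: mt.
case: (i == j) => /=; first exact: measurable_cst.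
case: (i < j)%N => /=; first by apply: measurable_funM => //; exact: mt.
by apply: measurableT_comp => //; apply: measurable_funM => //; exact: mt.
Qed.

Lemma measurable_conj_tuple d (K : finType) (U : K -> unitary_group R d) :
  measurable_fun setT (conj_tuple U).
Proof.
apply/measurable_fun_tnthP => i.
set x := enum_val i; set V : 'M[C]_d := U x.1.1.
rewrite (_ : _ \o _ = (fun t =>
    samx_coords (V ^t* *m samx_family_coord t x.1.1 *m V) x.1.2 x.2)).
  have mF : mxmeasurable (fun t : #|{: K * 'I_d * 'I_d}|.-tuple (measurableTypeR R) =>
      V ^t* *m samx_family_coord t x.1.1 *m V).
    apply: mxmeasurableM; last exact: mxmeasurable_cst.
    apply: mxmeasurableM; first exact: mxmeasurable_cst.
    exact: mxmeasurable_samx_family_coord.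
  rewrite /samx_coords; case: (x.1.2 == x.2); first exact: (mF _ _).1.
  by case: (x.1.2 < x.2)%N; apply: measurable_funM => //;
    [exact: (mF _ _).1|exact: (mF _ _).2].
apply/funext => t /=; exact: tnth_mktuple.
Qed.

Lemma lebesgue_power_conj_tuple d (K : finType) (U : K -> unitary_group R d) S :
  measurable S ->
  mpower (@lebesgue_measure R) #|{: K * 'I_d * 'I_d}| (conj_tuple U @^-1` S) =
  mpower (@lebesgue_measure R) #|{: K * 'I_d * 'I_d}| S.
Proof.
move=> mS; apply: isometry_lebesgue_power mS.
- exact: measurable_conj_tuple.
- exact: conj_tupleD.
- exact: conj_tupleK.
- exact: sqr_sum_conj_tuple.
Qed.

Lemma continuous_borel_measurable (T : ptopologicalType) (f : T -> R) :
  continuous f -> measurable_fun [set: borel T] f.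
Proof.
move=> /continuousP cf; apply: (measurability _ (RGenOpens.measurableE R)).
move=> _ [_ [a [b ->] <-]]; rewrite setTI; apply: sub_sigma_algebra.
exact/cf/interval_open.
Qed.

Lemma continuous_Re : continuous (Re : C -> R).
Proof.
move=> x; have FF : Filter (nbhs x) by exact: nbhs_filter.
apply/cvgrPdist_lt => e e0.
exists e%:C => [|t]; first by rewrite /= ltcR.
rewrite /ball_ /= => h.
rewrite -ltcR; apply: le_lt_trans h; apply: le_trans (normc_ge_Re _).
by clear FF; case: x t => a b [].
Qed.

Lemma continuous_Im : continuous (Im : C -> R).
Proof.
move=> x; have FF : Filter (nbhs x) by exact: nbhs_filter.
apply/cvgrPdist_lt => e e0.
exists e%:C => [|t]; first by rewrite /= ltcR.
rewrite /ball_ /= => h.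
rewrite -ltcR; apply: le_lt_trans h.
have -> : Im x - Im t = - Re ((x - t) * 'i%C) by clear FF; case: x t => a b [u v] /=; ring.
rewrite normrN; apply: le_trans (normc_ge_Re _) _.
by rewrite normrM (_ : `|'i%C| = 1) ?mulr1// normc_def /= expr0n add0r expr1n sqrtr1.
Qed.

Lemma continuous_mx_entry p q i j : continuous (fun A : 'M[C]_(p, q) => A i j).
Proof. exact: coord_continuous. Qed.

(** The bridge from Borel structures to entrywise measurability, used for the unitaries and for the
    matrix families. *)
Lemma mxmeasurable_borel (T : ptopologicalType) d (f : T -> 'M[C]_d) :
  continuous f -> mxmeasurable (W := borel T) f.
Proof.
move=> cf i j.
have cfij : continuous (fun t => f t i j).
  move=> t; apply: (@continuous_comp _ _ _ f (fun A => A i j)); first exact: cf.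
  exact: continuous_mx_entry.
split; apply: continuous_borel_measurable => t.
  by apply: (@continuous_comp _ _ _ (fun t => f t i j) Re);
    [exact: cfij|exact: continuous_Re].
by apply: (@continuous_comp _ _ _ (fun t => f t i j) Im);
  [exact: cfij|exact: continuous_Im].
Qed.

Lemma continuous_unitary_mx d : continuous (@unitary_mx R d).
Proof. exact: initial_continuous. Qed.

Lemma continuous_samx_val d : continuous (@samx_val R d).
Proof. exact: initial_continuous. Qed.

Lemma continuous_samx_family d (K : finType) k :
  continuous (fun F : samx_family R d K => F k : 'M[C]_d).
Proof.
move=> F; apply: (@continuous_comp _ _ _ (fun F : samx_family R d K => F k) (@samx_val R d)).
  exact: (@proj_continuous K (fun=> samx R d)).
exact: continuous_samx_val.
Qed.

End coordinates_measurability.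

Lemma mxmeasurable_comp (R : realType) d1 d2 (W1 : measurableType d1)
    (W2 : measurableType d2) p q (F : W2 -> 'M[R[i]]_(p, q)) (g : W1 -> W2) :
  mxmeasurable F -> measurable_fun setT g -> mxmeasurable (fun w => F (g w)).
Proof.
move=> mF mg i j; split.
  exact: (measurableT_comp (mF i j).1 mg).
exact: (measurableT_comp (mF i j).2 mg).
Qed.

(** * The extended logarithm on products and inequalities *)

Section lne_theory.
Context {R : realType}.
Implicit Types x y : \bar R.

Lemma lne0 : lne (0 : \bar R) = -oo%E.
Proof. exact: le0_lneNy. Qed.

(** No positivity is assumed: [lne] is -oo on nonpositive arguments. *)
Lemma le_lne x y : (x <= y)%E -> (lne x <= lne y)%E.
Proof.
move=> xy; have [x0|x0] := leP x 0%E; first by rewrite le0_lneNy// leNye.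
by rewrite lee_lne// in_itv/= leey andbT ltW// (lt_le_trans x0).
Qed.

Lemma lne_lty x : (x < +oo)%E -> (lne x < +oo)%E.
Proof. by case: x => [x| |]//= _; case: ifP => // _; exact: ltry. Qed.

Lemma lneM_finite x y : (0 <= x < +oo)%E -> (0 <= y < +oo)%E ->
  lne (x * y) = (lne x + lne y)%E.
Proof.
move=> /andP[x0 xoo] /andP[y0 yoo].
have [->|x0'] := eqVneq x 0%E.
  by rewrite mul0e lne0 addNye.
have [->|y0'] := eqVneq y 0%E.
  by rewrite mule0 lne0 addeNy.
by apply: lneM; rewrite in_itv/= leey andbT lt0e ?x0' ?y0'.
Qed.

Lemma prode_finite (I : Type) (s : seq I) (f : I -> \bar R) :
  (forall i, (0 <= f i < +oo)%E) -> (0 <= \prod_(i <- s) f i < +oo)%E.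
Proof.
move=> f0; elim/big_ind : _ => //; first by rewrite lee01 ltry.
move=> x y /andP[x0 xoo] /andP[y0 yoo].
by rewrite mule_ge0// lte_mul_pinfty// ge0_fin_numE.
Qed.

Lemma lne_prod (I : Type) (s : seq I) (f : I -> \bar R) :
  (forall i, (0 <= f i < +oo)%E) ->
  lne (\prod_(i <- s) f i) = (\sum_(i <- s) lne (f i))%E.
Proof.
move=> f0; elim: s => [|i s ih]; first by rewrite !big_nil lne1.
by rewrite !big_cons lneM_finite// ?ih// prode_finite.
Qed.

Lemma lne_le_inv (c : R) x : 0 < c -> (c%:E * x <= 1)%E -> (lne x <= (- ln c)%:E)%E.
Proof.
move=> c0; case: x => [x| |].
- rewrite -EFinM lee_fin => h; have [x0|x0] := leP x 0.
    by rewrite le0_lneNy ?lee_fin// leNye.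
  rewrite lne_EFin// lee_fin -lnV ?posrE// ler_ln ?posrE ?invr_gt0//.
  by rewrite -[leRHS]mulr1 mulrC ler_pdivlMr// mulrC.
- by rewrite gt0_muley ?lte_fin// leye_eq.
- by rewrite leNye.
Qed.

End lne_theory.

(** * Volumes of the microstate spaces *)

Section microstate_volume.
Context (R : realType) (A : cstar_algebra R) (phi : cstar_state A).
Variables (I J : finType) (X : I -> A) (Y : J -> A).

Lemma measurable_microstates_coord r M d eps : 0 <= r ->
  measurable (@samx_family_coord R d _ @^-1` microstates phi X Y r M d eps).
Proof.
move=> r0; apply: measurable_microstates => // k.
exact: (mxmeasurable_samx_family_coord (f := id)).
Qed.

Lemma samx_lebesgue_microstates_finite r M d eps : 0 <= r ->
  (0 <= samx_lebesgue (microstates phi X Y r M d eps) < +oo)%E.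
Proof.
move=> r0; rewrite measure_ge0 /=.
apply: lebesgue_power_bounded; first exact: measurable_microstates_coord.
by move=> t; exact: microstates_sqr_sum.
Qed.

(* The Gaussian bound for the variance [1 / d], at which the volume of the ball
   of radius [sqrt (#|I + J| * d) * r] is [d ^ (- #|I + J| * d ^ 2 / 2)] up to a
   factor exponential in [d ^ 2]. *)
Lemma chi_fin_le r M d eps : 0 <= r -> (0 < d)%N ->
  (((d%:R ^+ 2)^-1)%:E * chi_fin phi X Y r M d eps
    + ((#|I| + #|J|)%N%:R / 2 * ln d%:R)%:E <=
   ((#|I| + #|J|)%N%:R / 2 * (ln (pi *+ 2) + r ^+ 2))%:E)%E.
Proof.
move=> r0 d0; set K : R := (#|I| + #|J|)%N%:R.
have dR0 : 0 < d%:R :> R by rewrite ltr0n.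
set D : R := d%:R in dR0 *.
pose s : R := (Num.sqrt D)^-1.
have s0 : s != 0 by rewrite invr_eq0 sqrtr_eq0 -ltNge.
have s2 : s ^+ 2 = D^-1 by rewrite exprVn sqr_sqrtr// ltW.
have := lebesgue_power_gauss_bound s0 (measurable_microstates_coord M eps r0)
  (fun t => @microstates_sqr_sum _ _ _ _ _ X Y r M d eps t r0).
set c := (_ * _)%R => h.
have p0 := normal_peak_gt0 s0.
have c0 : 0 < c by rewrite mulr_gt0 ?expR_gt0// exprn_gt0.
have := lne_le_inv c0 h.
rewrite -[lne _]/(chi_fin phi X Y r M d eps).
have lnp : ln (normal_peak s) = - (ln (pi *+ 2) - ln D) / 2.
  rewrite /normal_peak s2 lnV ?posrE ?sqrtr_gt0; last first.
    by rewrite mulrn_wgt0// mulr_gt0 ?pi_gt0// invr_gt0.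
  rewrite -powR12_sqrt; last first.
    by rewrite mulrn_wge0// mulr_ge0 ?pi_ge0// invr_ge0 ltW.
  have pi2 : 0 < pi *+ 2 :> R by rewrite mulrn_wgt0// pi_gt0.
  rewrite ln_powR -mulrnAr lnM ?posrE ?invr_gt0//.
  by rewrite (lnV (x := D)) ?posrE//; field.
(* There are [K * D ^+ 2] coordinates, and the exponent, squared radius [K * D * r ^+ 2] over
   [2 / D], is [K * D ^+ 2 * r ^+ 2 / 2]; hence both contributions scale with [D ^+ 2]. *)
have -> : - ln c = D ^+ 2 * (K / 2 * (ln (pi *+ 2) + r ^+ 2) - K / 2 * ln D).
  rewrite /c lnM ?posrE ?exprn_gt0 ?expR_gt0// lnXn// expRK lnp s2.
  have cN : #|{: (I + J) * 'I_d * 'I_d}|%:R = K * D * D :> R.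
    by rewrite !card_prod !card_ord card_sum !natrM.
  rewrite -[X in - (X + _)]mulr_natr cN card_sum -/K -/D -[D^-1 *+ 2]mulr_natr.
  by field; rewrite gt_eqF.
case: (chi_fin _ _ _ _ _ _ _) => [z| |]; rewrite ?leye_eq//.
- rewrite !lee_fin => hz; rewrite -lerBrDr.
  by rewrite ler_pdivrMl// exprn_gt0.
- by move=> _; rewrite gt0_muleNy ?leNye// lte_fin invr_gt0 exprn_gt0.
Qed.

End microstate_volume.

Section averaging.
Context (R : realType) (A : cstar_algebra R) (phi : cstar_state A).
Variable gamma : forall d, probability (borel (unitary_group R d)) R.
Variables (l : nat) (n m : 'I_l -> nat).
Variables (X : forall k, 'I_(n k) -> A) (Y : forall k, 'I_(m k) -> A).
Local Notation RT := (measurableTypeR R).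
Local Notation K := (joint_index n m).
Local Notation space d := (samx_family R d K).
Local Notation N d := #|{: K * 'I_d * 'I_d}|.
Local Notation lam d := (mpower (@lebesgue_measure R) (N d)).
Local Notation Gam r M d eps :=
  (microstates phi (joint_family X) (joint_family Y) r M d eps).

Definition unfamily_index (t : K) : 'I_(n (color t)) + 'I_(m (color t)) :=
  match t with inl s => inl (tagged s) | inr s => inr (tagged s) end.

Lemma unfamily_indexK t : family_index (unfamily_index t) = t.
Proof. by case: t => -[]. Qed.

Section block_index.
Variable d : nat.
Local Notation P k := #|{: ('I_(n k) + 'I_(m k)) * 'I_d * 'I_d}|.

(** Coordinates are numbered by two unrelated enumerations, so the position is computed through the
    triple of a variable and two matrix indices. *)
Definition block_index (k : 'I_l) (j : 'I_(P k)) : 'I_(N d) :=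
  let x := enum_val j in enum_rank (family_index x.1.1, x.1.2, x.2).

Lemma block_index_bij :
  bijective (fun s : {k : 'I_l & 'I_(P k)} => block_index (tagged s)).
Proof.
pose h (x : K * 'I_d * 'I_d) : {k : 'I_l & 'I_(P k)} :=
  existT (fun k => 'I_(P k)) (color x.1.1)
    (enum_rank (unfamily_index x.1.1, x.1.2, x.2)).
exists (fun i => h (enum_val i)).
  move=> [k j]; rewrite /block_index enum_rankK /= -[RHS]/(existT (fun k => 'I_(P k)) k j).
  rewrite -[j in RHS]enum_valK; case: (enum_val j) => [[[a|a] b] c] //.
move=> i; rewrite /block_index /= enum_rankK /= unfamily_indexK.
by rewrite -!surjective_pairing enum_valK.
Qed.

Lemma samx_family_coord_block (t : (N d).-tuple RT) k :
  samx_family_coord (tuple_sub (@block_index k) t) =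
  (fun s => samx_family_coord t (family_index s)).
Proof.
apply/funext => s; rewrite /samx_family_coord; congr samx_coord.
apply/funext => i; apply/funext => j.
by rewrite tnth_mktuple /block_index enum_rankK.
Qed.

Lemma samx_lebesgue_blocks r M eps : 0 <= r ->
  lam d [set t | forall k, microstates phi (@X k) (@Y k) r M d eps
    (fun s => samx_family_coord t (family_index s))] =
  (\prod_(k < l) samx_lebesgue (microstates phi (@X k) (@Y k) r M d eps))%E.
Proof.
move=> r0.
pose B k : R := #|{: 'I_(n k) + 'I_(m k)}|%:R * (d%:R * r ^+ 2).
have B0 k : 0 <= B k by rewrite mulr_ge0// mulr_ge0// sqr_ge0.
pose S k := @samx_family_coord R d _ @^-1` microstates phi (@X k) (@Y k) r M d eps.
have mS k : measurable (S k) by exact: measurable_microstates_coord.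
(* [B k] bounds the sum of squares in block [k]. A real [x] satisfies |x| <= 1 or |x| <= x^2, and
   summing over [k] gives one bound for all blocks. *)
have bS k t : S k t -> forall i, `|tnth t i : R| <= 1 + \sum_k B k.
  move=> St i; have := microstates_sqr_sum r0 St.
  rewrite -/(B k) /sqr_sum (bigD1 i)//= => h.
  have {}h : (tnth t i : R) ^+ 2 <= \sum_k B k.
    apply: le_trans (_ : B k <= _); last by rewrite (bigD1 k)//= lerDl sumr_ge0.
    by apply: le_trans h; rewrite lerDl sumr_ge0// => ? _; rewrite sqr_ge0.
  have [h1|/ltW h1] := leP `|tnth t i : R| 1.
    by rewrite (le_trans h1)// lerDl sumr_ge0.
  apply: (@le_trans _ _ (\sum_k B k)); last by rewrite lerDr.
  apply: le_trans h; rewrite -[leRHS]real_normK ?num_real//.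
  by rewrite expr2 ler_peMr.
rewrite -(lebesgue_power_block block_index_bij mS bS).
congr (lam d _); apply/seteqP; split=> t h k; have := h k;
  by rewrite /S /= samx_family_coord_block.
Qed.

End block_index.

Section fixed_size.
Variables (r : R) (M d : nat) (eps : R).
Hypothesis r0 : 0 <= r.
Local Notation UT := (borel (unitary_group R d)).
Local Notation haar := (mpower (gamma d) l).

(** Both arguments vary over an arbitrary space [W], which covers unitaries with coordinate tuples,
    unitaries with Borel families, and unitaries with a fixed family. *)
Lemma mxmeasurable_orbital d0 (W : measurableType d0) (u : W -> l.-tuple UT)
    (F : W -> space d) :
  measurable_fun setT u -> (forall k, mxmeasurable (fun w => F w k : 'M[R[i]]_d)) ->
  measurable [set w | Gam r M d eps (orbital_map (u w, F w))].
Proof.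
move=> mu mF.
rewrite -[X in measurable X]/((fun w => orbital_map (u w, F w)) @^-1` Gam r M d eps).
apply: measurable_microstates => // k.
have mU : mxmeasurable (fun w => tnth (u w) (color k) : 'M[R[i]]_d).
  apply: (mxmeasurable_comp (g := fun w => tnth (u w) (color k))
    (mxmeasurable_borel (@continuous_unitary_mx R d))).
  by move/measurable_fun_tnthP : mu => /(_ (color k)).
apply: (mxmeasurableM (F := fun w => (tnth (u w) (color k) : 'M[R[i]]_d) ^t* *m F w k)) => //.
by apply: mxmeasurableM => //; exact: mxmeasurable_adj.
Qed.

Lemma haar_setT : haar setT = 1%E.
Proof. by apply: mpower_setT; exact: probability_setT. Qed.

(* Average over the unitaries, using that conjugation preserves the Lebesgue
   measure, and exchange the integrals. *)
Lemma lebesgue_microstates_le (s : \bar R) : (0 <= s)%E ->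
  (forall F : space d, haar [set u | Gam r M d eps (orbital_map (u, F))] <= s)%E ->
  (samx_lebesgue (Gam r M d eps) <=
   s * \prod_(k < l) samx_lebesgue (microstates phi (@X k) (@Y k) r M d eps))%E.
Proof.
move=> s0 hs; rewrite -samx_lebesgue_blocks//.
pose P : set ((N d).-tuple RT) := [set t | forall k,
  microstates phi (@X k) (@Y k) r M d eps (fun s => samx_family_coord t (family_index s))].
rewrite -[lam d _]/(lam d P).
have mP : measurable P.
  rewrite (_ : P = \bigcap_(k : 'I_l) (tuple_sub (@block_index d k) @^-1`
     (@samx_family_coord R d _ @^-1` microstates phi (@X k) (@Y k) r M d eps))).
    apply: fin_bigcap_measurable => // k _.
    apply: (measurable_preimage (measurable_tuple_sub (@block_index d k))).
    exact: measurable_microstates_coord.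
  apply/seteqP; split=> t h k; have := h k; rewrite /P /= samx_family_coord_block//.
  exact: (fun h' => h' I).
pose S : set (l.-tuple UT * (N d).-tuple RT) :=
  [set z | Gam r M d eps (orbital_map (z.1, samx_family_coord z.2))].
have mS : measurable S.
  apply: (mxmeasurable_orbital (u := fst) (F := fun z => samx_family_coord z.2)) => //.
  by move=> k; exact: mxmeasurable_samx_family_coord.
have mG : measurable (@samx_family_coord R d _ @^-1` Gam r M d eps).
  exact: measurable_microstates_coord.
have <- : (\int[haar]_u lam d [set t | S (u, t)] = samx_lebesgue (Gam r M d eps))%E.
  under eq_integral => u _.
    rewrite (_ : lam d _ = samx_lebesgue (Gam r M d eps)); last first.
      rewrite /samx_lebesgue.
      rewrite -[RHS](lebesgue_power_conj_tuple (fun k : K => tnth u (color k)) mG).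
      by congr (lam d _); apply/seteqP; split=> t; rewrite /S /= conj_tupleE.
    over.
  rewrite integral_cst// -[RHS]mule1; congr mule; exact: haar_setT.
rewrite (exchange_measure_section haar (lam d) mS).
have -> : (s * lam d P = \int[lam d]_t (s * (\1_P t)%:E))%E.
  rewrite ge0_integralZl//; first by rewrite integral_indic// setIT.
  exact/measurable_EFinP/measurable_indic.
apply: ge0_le_integral => //.
- apply: (eq_measurable_fun (fun y => haar (ysection S y))).
    move=> t _; congr (haar _); rewrite /ysection; apply/seteqP.
    by split=> u /=; rewrite inE.
  exact: measurable_fun_ysection.
- by apply: emeasurable_funM => //; exact/measurable_EFinP/measurable_indic.
(* Inside [P] the section is bounded by [s]; outside [P] it is empty, since a conjugate in the joint
   microstates would put every block of [t] among the microstates of its family. *)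
move=> t _; rewrite indicE; have [Pt|nPt] := pselect (P t).
  rewrite (mem_set Pt) mule1; exact: (hs (samx_family_coord t)).
rewrite (memNset nPt) mule0 -(measure0 haar) le_eqVlt; apply/orP; left.
apply/eqP; congr (haar _); apply/seteqP; split=> u //= Su; apply: nPt.
exact: (microstates_family (U := fun k => tnth u k) r0 Su).
Qed.

End fixed_size.

End averaging.

(** * Limits of antitone families *)

Section directed_infimum.
Context {R : realType}.
Implicit Types x y : \bar R.

(** Comparison with real upper bounds of [y] also covers [y = -oo], where adding a small constant
    says nothing. *)
Lemma lee_real_upper x y : (forall c : R, (y < c%:E)%E -> (x <= c%:E)%E) -> (x <= y)%E.
Proof.
case: y => [y| |] h; last 2 first.
- by rewrite leey.
- rewrite leNgt; apply/negP => x0; have := h _ (ltNyr 0).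
  case: x x0 h => [x| |]// _ h _.
  by have := h (x - 1)%R (ltNyr _); rewrite lee_fin; lra.
apply/lee_addgt0Pr => e e0; rewrite -EFinD; apply: h.
by rewrite lte_fin ltrDl.
Qed.

(** Two real summands share the gap equally; a summand -oo takes whatever the other leaves. A
    summand +oo has to be excluded, because its sum with -oo is -oo. *)
Lemma lte_split x y (c : R) : (x < +oo)%E -> (y < +oo)%E -> (x + y < c%:E)%E ->
  exists a b : R, [/\ (x < a%:E)%E, (y < b%:E)%E & a + b = c].
Proof.
case: x => [x| |]// _; case: y => [y| |]// _ h.
- rewrite -EFinD lte_fin in h.
  exists (x + (c - (x + y)) / 2), (y + (c - (x + y)) / 2).
  by rewrite !lte_fin; split; [lra|lra|field].
- by exists (x + 1), (c - (x + 1)); rewrite lte_fin ltNyr; split=> //; lra.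
- by exists (c - (y + 1)), (y + 1); rewrite lte_fin ltNyr; split=> //; lra.
- by exists (c - 1), 1; rewrite !ltNyr; split=> //; lra.
Qed.

(** * Infima of sums of antitone functions on a directed set *)

Section antitone.
Variables (T : Type) (D : set T) (le : T -> T -> Prop).
Hypothesis D_directed : forall s t, D s -> D t ->
  exists u, [/\ D u, le s u & le t u].
Hypothesis D_nonempty : D !=set0.

Definition antitone (f : T -> \bar R) :=
  forall s t, D s -> D t -> le s t -> (f t <= f s)%E.

Lemma ereal_inf_lty (f : T -> \bar R) : (forall t, D t -> (f t < +oo)%E) ->
  (ereal_inf (f @` D) < +oo)%E.
Proof.
move=> foo; have [t Dt] := D_nonempty.
by apply: le_lt_trans (foo _ Dt); apply: ereal_inf_lbound; exists t.
Qed.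

(** Near-minimal values of [f] and [g], attained at different points, hold together at a common
    later point. This serves twice: for the tails of a limit superior and for the pairs (M, eps). *)
Lemma ereal_inf_add (f g : T -> \bar R) : antitone f -> antitone g ->
  (forall t, D t -> (f t < +oo)%E) -> (forall t, D t -> (g t < +oo)%E) ->
  (ereal_inf [set (f t + g t)%E | t in D] <=
   ereal_inf (f @` D) + ereal_inf (g @` D))%E.
Proof.
move=> fdec gdec foo goo; apply: lee_real_upper => c.
move=> /(lte_split (ereal_inf_lty foo) (ereal_inf_lty goo)) [a [b [fa gb <-]]].
have [_ [s Ds <-] /ltW sa] := ereal_inf_lt fa.
have [_ [t Dt <-] /ltW tb] := ereal_inf_lt gb.
have [u [Du su tu]] := D_directed Ds Dt.
apply: (@le_trans _ _ (f u + g u)%E); first by apply: ereal_inf_lbound; exists u.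
rewrite EFinD; apply: leeD; first exact: le_trans (fdec _ _ Ds Du su) sa.
exact: le_trans (gdec _ _ Dt Du tu) tb.
Qed.

Lemma ereal_inf_sum (I : Type) (s : seq I) (f : I -> T -> \bar R) :
  (forall i, antitone (f i)) -> (forall i t, D t -> (f i t < +oo)%E) ->
  (ereal_inf [set (\sum_(i <- s) f i t)%E | t in D] <=
   \sum_(i <- s) ereal_inf (f i @` D))%E.
Proof.
move=> fdec foo; elim: s => [|i s ih].
  rewrite big_nil; have [t Dt] := D_nonempty.
  by apply: ereal_inf_lbound; exists t => //; rewrite big_nil.
rewrite big_cons; apply: le_trans (leeD2l _ ih).
rewrite (_ : [set _ | _ in D] =
  [set (f i t + \sum_(j <- s) f j t)%E | t in D]); last first.
  by congr image; apply/funext => t; rewrite big_cons.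
apply: ereal_inf_add; [exact: fdec| |exact: foo|].
- by move=> t u Dt Du tu; apply: lee_sum => j _; exact: fdec.
- by move=> t Dt; apply: lte_sum_pinfty => j _; exact: foo.
Qed.

End antitone.

Lemma limn_esup_inf (u : nat -> \bar R) :
  limn_esup u = ereal_inf [set esups u N | N in setT].
Proof.
rewrite limn_esup_lim; apply/cvg_lim => //.
exact/ereal_nonincreasing_cvgn/nonincreasing_esups.
Qed.

Lemma esups_ge (u : nat -> \bar R) N k : (N <= k)%N -> (u k <= esups u N)%E.
Proof. by move=> Nk; apply: ereal_sup_ubound; exists k. Qed.

Lemma esups_le (u : nat -> \bar R) N x : (forall k, (u k <= x)%E) -> (esups u N <= x)%E.
Proof. by move=> ux; apply: ge_ereal_sup => _ [k _ <-]. Qed.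

Lemma limn_esup_le (u v : nat -> \bar R) : (forall k, u k <= v k)%E ->
  (limn_esup u <= limn_esup v)%E.
Proof.
move=> uv; rewrite !limn_esup_inf; apply: le_ereal_inf_tmp => _ [N _ <-].
apply: (@le_trans _ _ (esups u N)); first by apply: ereal_inf_lbound; exists N.
apply: ge_ereal_sup => _ [k /= Nk <-]; apply: le_trans (uv k) _.
exact: esups_ge.
Qed.

Lemma limn_esup_ub (u : nat -> \bar R) x : (forall k, (u k <= x)%E) -> (limn_esup u <= x)%E.
Proof.
move=> ux; rewrite limn_esup_inf; apply: le_trans (esups_le 0 ux).
by apply: ereal_inf_lbound; exists 0%N.
Qed.

(** The tail suprema are antitone, and the bounds [c i], uniform in the index of the sequence, keep
    them below +oo. *)
Lemma limn_esup_sum (I : Type) (s : seq I) (u : nat -> \bar R)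
    (f : I -> nat -> \bar R) (c : I -> R) :
  (forall i k, (f i k <= (c i)%:E)%E) -> (forall k, (u k <= \sum_(i <- s) f i k)%E) ->
  (limn_esup u <= \sum_(i <- s) limn_esup (f i))%E.
Proof.
move=> fc uf; under eq_bigr do rewrite limn_esup_inf.
apply: le_trans (@ereal_inf_sum _ setT (fun a b => (a <= b)%N) _ _ _ s
  (fun i => esups (f i)) _ _).
- rewrite limn_esup_inf; apply: le_ereal_inf_tmp => _ [N _ <-].
  apply: (@le_trans _ _ (esups u N)); first by apply: ereal_inf_lbound; exists N.
  apply: ge_ereal_sup => _ [k /= Nk <-]; apply: le_trans (uf k) _.
  by apply: lee_sum => i _; exact: esups_ge.
- by move=> a b _ _; exists (maxn a b); rewrite leq_maxl leq_maxr.
- by exists 0%N.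
- by move=> i a b _ _ ab; exact: nonincreasing_esups.
- by move=> i a _; apply: le_lt_trans (esups_le _ (fc i)) (ltry _).
Qed.

Lemma muleD_lty (c : R) x y : 0 <= c -> (x < +oo)%E -> (y < +oo)%E ->
  (c%:E * (x + y) = c%:E * x + c%:E * y)%E.
Proof.
rewrite le_eqVlt => /predU1P[<-|c0]; first by rewrite !mul0e adde0.
case: x => [x| |]// _; case: y => [y| |]// _.
- exact: (congr1 EFin (mulrDr c x y)).
- by rewrite addeNy gt0_muleNy// addeNy.
- by rewrite addNye gt0_muleNy// addNye.
- by rewrite addNye gt0_muleNy// addNye.
Qed.

Lemma mule_sum_lty (c : R) (I : Type) (s : seq I) (f : I -> \bar R) : 0 <= c ->
  (forall i, (f i < +oo)%E) ->
  (c%:E * \sum_(i <- s) f i = \sum_(i <- s) (c%:E * f i))%E.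
Proof.
move=> c0 foo; elim: s => [|i s ih]; first by rewrite !big_nil mule0.
by rewrite !big_cons muleD_lty// ?ih// lte_sum_pinfty.
Qed.

End directed_infimum.

(** * The entropy inequality *)

Section dirac_regularity.
Context {R : realType}.

Lemma closed_samx_family1 d (K : finType) (F : samx_family R d K) :
  closed [set F].
Proof.
rewrite (_ : [set F] = \bigcap_(x in [set: K * 'I_d * 'I_d])
  ((fun G : samx_family R d K => complex.Re (G x.1.1 x.1.2 x.2)) @^-1`
     [set complex.Re (F x.1.1 x.1.2 x.2)] `&`
   (fun G : samx_family R d K => complex.Im (G x.1.1 x.1.2 x.2)) @^-1`
     [set complex.Im (F x.1.1 x.1.2 x.2)])).
  have entry (k : K) i j : continuous (fun G : samx_family R d K => G k i j : R[i]).
    move=> G; apply: (@continuous_comp _ _ _ (fun G : samx_family R d K => G k : 'M[R[i]]_d)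
      (fun B => B i j)); first exact: continuous_samx_family.
    exact: continuous_mx_entry.
  apply: closed_bigI => -[[k i] j] _; apply: closedI => /=.
    apply: preimage_closed; last exact: closed_eq.
    move=> G _; apply: (@continuous_comp _ _ _ (fun G : samx_family R d K => G k i j : R[i])
      (@complex.Re R)); [exact: entry|exact: continuous_Re].
  apply: preimage_closed; last exact: closed_eq.
  move=> G _; apply: (@continuous_comp _ _ _ (fun G : samx_family R d K => G k i j : R[i])
      (@complex.Im R)); [exact: entry|exact: continuous_Im].
apply/seteqP; split=> [_ -> x _//|G h]; apply/funext => k; apply/val_inj.
apply/matrixP => i j; have [/= hr hi] := h (k, i, j) I.
by apply/eqP; rewrite eq_complex hr hi !eqxx.
Qed.

(** If [F] is in [S], the whole space and the point [F] attain the infimum and the supremum;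
    otherwise the complement of the point, open by [closed_samx_family1], and the empty set do. *)
Lemma regular_dirac d (K : finType) (F : borel (samx_family R d K)) :
  regular_measure (dirac F : {measure set (borel (samx_family R d K)) -> \bar R}).
Proof.
set mu : {measure set _ -> \bar R} := dirac F.
have muE B : mu B = ((F \in B)%:R)%:E by [].
have mu_ge0 B : (0 <= mu B)%E by rewrite muE lee_fin.
have mu_le1 B : (mu B <= 1)%E by rewrite muE lee_fin; case: (F \in B).
move=> S mS; have [FS|FS] := pselect (S F); rewrite [mu S]muE.
  rewrite mem_set//; split; apply/eqP; rewrite eq_le; apply/andP; split.
  - apply: le_ereal_inf_tmp => _ [U [oU SU] <-].
    by rewrite muE mem_set//; exact: SU.
  - apply: ereal_inf_lbound; exists setT; last by rewrite muE mem_set.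
    by split=> //; exact: openT.
  - apply: ereal_sup_ubound; exists [set F]; last by rewrite muE mem_set.
    by split; [exact: compact_set1|move=> _ ->].
  - by apply: ge_ereal_sup => _ [U _ <-].
rewrite memNset//; split; apply/eqP; rewrite eq_le; apply/andP; split.
- by apply: le_ereal_inf_tmp => _ [U _ <-].
- apply: ereal_inf_lbound; exists (~` [set F]); last by rewrite muE memNset//=; apply.
  split; first exact/closed_openC/closed_samx_family1.
  by move=> G GS /= GF; apply: FS; rewrite -GF.
- apply: ereal_sup_ubound; exists set0; last by rewrite muE memNset.
  by split; [exact: compact0|].
- apply: ge_ereal_sup => _ [U [_ US] <-]; rewrite muE memNset//.
  by move=> /US.
Qed.

End dirac_regularity.

Section entropy_inequality.
Context (R : realType) (A : cstar_algebra R) (phi : cstar_state A).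
Variable gamma : forall d, probability (borel (unitary_group R d)) R.
Variables (l : nat) (n m : 'I_l -> nat).
Variables (X : forall k, 'I_(n k) -> A) (Y : forall k, 'I_(m k) -> A).
Local Notation K := (joint_index n m).
Local Notation space d := (samx_family R d K).
Local Notation jX := (joint_family X).
Local Notation jY := (joint_family Y).
Local Notation Gam r M d eps := (microstates phi jX jY r M d eps).
Local Notation chi_orb_fin := (chi_orb_fin phi gamma X Y).
Local Notation chi_orb_limsup := (chi_orb_limsup phi gamma X Y).

Lemma measurable_orbital_preimage r M d eps : 0 <= r ->
  measurable (@orbital_map R l n m d @^-1` Gam r M d eps).
Proof.
move=> r0; apply: (@mxmeasurable_orbital R A phi l n m X Y r M d eps r0 _
  (l.-tuple (borel (unitary_group R d)) * borel (space d))%type fst snd) => // k.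
apply: (mxmeasurable_comp (g := snd)
  (mxmeasurable_borel (@continuous_samx_family R d K k))) => //.
Qed.

Lemma chi_orb_fin_le0 r M d eps : 0 <= r -> (chi_orb_fin r M d eps <= 0)%E.
Proof.
move=> r0; apply: ge_ereal_sup => _ [mu _ <-].
rewrite lne_le0.
have <- : (mpower (gamma d) l \x mu)%E setT = 1%E.
  rewrite -setXTT product_measure1E// -[RHS]mul1e; congr mule.
    exact: haar_setT.
  exact: probability_setT.
by apply: le_measure => //; rewrite inE//; exact: measurable_orbital_preimage.
Qed.

(** For the Dirac measure at [F] the product measure of the preimage is the measure of its section
    at [F]. *)
Lemma chi_orb_fin_ge r M d eps (F : space d) : 0 <= r ->
  (mpower (gamma d) l [set u | Gam r M d eps (orbital_map (u, F))] <=
   expeR (chi_orb_fin r M d eps))%E.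
Proof.
move=> r0; set S := [set u | _].
have mS : measurable S.
  apply: (@mxmeasurable_orbital R A phi l n m X Y r M d eps r0 _ _ id (fun=> F)) => //.
have S0 : (0 <= mpower (gamma d) l S)%E by exact: measure_ge0.
have /eqP <- : expeR (lne (mpower (gamma d) l S)) == mpower (gamma d) l S.
  by rewrite lneK_eq.
rewrite lee_expeR; apply: ereal_sup_ubound.
exists (dirac (F : borel (space d))); first exact: regular_dirac.
rewrite /chi_orb_fin_measure; congr lne.
rewrite /product_measure1 -[RHS]mul1e -integral_cst// integral_mkcond.
apply: eq_integral => u _; rewrite patchE /=.
rewrite /dirac indicE /xsection /=.
have -> : (F \in [set y | (u, y) \in @orbital_map R l n m d @^-1` Gam r M d eps]) = (u \in S).
  apply/idP/idP => [/set_mem/set_mem h|/set_mem h]; apply/mem_set; first exact: h.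
  exact/mem_set.
by case: (u \in S).
Qed.

(** The averaging bound with [s] the exponential of the orbital entropy; nonpositivity of the latter
    keeps [s] finite, so the logarithm splits the product. *)
Lemma chi_fin_le_orb r M d eps : 0 <= r ->
  (chi_fin phi jX jY r M d eps <=
   chi_orb_fin r M d eps + \sum_(k < l) chi_fin phi (@X k) (@Y k) r M d eps)%E.
Proof.
move=> r0; have L0 := chi_orb_fin_le0 M d eps r0.
have h := lebesgue_microstates_le (gamma := gamma) (X := X) (Y := Y) r0
  (expeR_ge0 (chi_orb_fin r M d eps)) (fun F => chi_orb_fin_ge M eps F r0).
apply: (le_trans (le_lne h)).
have fin k := samx_lebesgue_microstates_finite phi (@X k) (@Y k) M d eps r0.
rewrite lneM_finite ?prode_finite//; first by rewrite expeRK lne_prod.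
rewrite expeR_ge0 /=; case: (chi_orb_fin _ _ _ _) L0 => [z| |]//= _.
exact: ltry.
Qed.

Lemma card_tagged_ord (p : 'I_l -> nat) : #|{: {k : 'I_l & 'I_(p k)}}| = (\sum_(k < l) p k)%N.
Proof.
rewrite card_tagged sumnE big_map big_enum /=.
by apply: eq_bigr => k _; rewrite card_ord.
Qed.

(** [None] stands for the orbital term. Treating it as one more index lets a single finite sum pass
    through the limit superior and the infimum. *)
Let term r M eps (o : option 'I_l) (d : nat) : \bar R :=
  match o with
  | None => ((d%:R ^+ 2)^-1)%:E * chi_orb_fin r M d eps
  | Some k => ((d%:R ^+ 2)^-1)%:E * chi_fin phi (@X k) (@Y k) r M d eps
      + ((#|'I_(n k)| + #|'I_(m k)|)%N%:R / 2 * ln d%:R)%:E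
  end%E.

Let bound r (o : option 'I_l) : R :=
  if o is Some k then (#|'I_(n k)| + #|'I_(m k)|)%N%:R / 2 * (ln (pi *+ 2) + r ^+ 2)
  else 0.

Let term_le r M eps o d : 0 <= r -> (term r M eps o d <= (Num.max 0 (bound r o))%:E)%E.
Proof.
(* At [d = 0] the conventions [0^-1 = 0] and [ln 0 = 0] make the term 0, which the maximum with 0
   absorbs. *)
move=> r0; case: d => [|d].
  have -> : term r M eps o 0 = 0%E.
    case: o => [k|]; rewrite /term /= expr0n invr0 mul0e//.
    by rewrite ln0// mulr0 adde0.
  by rewrite lee_fin le_max lexx.
case: o => [k|] /=.
  by apply: (le_trans (chi_fin_le _ _ _ _ _ r0 _)) => //; rewrite lee_fin le_max lexx orbT.
apply: (@le_trans _ _ 0%E); last by rewrite lee_fin le_max lexx.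
by rewrite mule_ge0_le0 ?chi_orb_fin_le0// lee_fin invr_ge0 sqr_ge0.
Qed.

Let options : seq (option 'I_l) := None :: map Some (index_enum 'I_l).

(** The correction by log d is additive, since the joint number of variables is the sum over the
    families and the orbital term carries none. *)
Let chi_fin_term r M d eps : 0 <= r ->
  (((d%:R ^+ 2)^-1)%:E * chi_fin phi jX jY r M d eps
    + ((#|{: {k : 'I_l & 'I_(n k)}}| + #|{: {k : 'I_l & 'I_(m k)}}|)%N%:R / 2 * ln d%:R)%:E <=
  \sum_(o <- options) term r M eps o d)%E.
Proof.
move=> r0; rewrite /options big_cons big_map /= big_split /= addeA.
have c0 : 0 <= (d%:R ^+ 2)^-1 :> R by rewrite invr_ge0 sqr_ge0.
have fin k : (chi_fin phi (@X k) (@Y k) r M d eps < +oo)%E.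
  have /andP[] := samx_lebesgue_microstates_finite phi (@X k) (@Y k) M d eps r0.
  by move=> _; exact: lne_lty.
rewrite -mule_sum_lty// -muleD_lty//; last 2 first.
- exact: le_lt_trans (chi_orb_fin_le0 _ _ _ r0) _.
- by rewrite lte_sum_pinfty.
apply: leeD; first by apply: lee_wpmul2l; [rewrite lee_fin|exact: chi_fin_le_orb].
rewrite sumEFin lee_fin -mulr_suml -mulr_suml !card_tagged_ord natrD !natr_sum -big_split /=.
rewrite le_eqVlt; apply/orP; left; apply/eqP; congr (_ / _ * _).
by apply: eq_bigr => k _; rewrite !card_ord natrD.
Qed.

Lemma chi_limsup_le r M eps : 0 <= r ->
  (chi_limsup phi jX jY r M eps <=
   chi_orb_limsup r M eps + \sum_(k < l) chi_limsup phi (@X k) (@Y k) r M eps)%E.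
Proof.
move=> r0.
have := @limn_esup_sum R _ options _ (term r M eps) (fun o => Num.max 0 (bound r o))
  (fun o d => term_le M eps o d r0) (fun d => chi_fin_term M d eps r0).
by rewrite /options big_cons big_map.
Qed.

Lemma microstates_antitone (I J : finType) (x : I -> A) (y : J -> A) r M M' d eps eps' :
  (M <= M')%N -> eps' <= eps ->
  microstates phi x y r M' d eps' `<=` microstates phi x y r M d eps.
Proof.
move=> MM' ee' F [h1 h2]; split=> // p q /andP[pq0 pq].
by apply: lt_le_trans ee'; apply: h2; rewrite pq0 (leq_trans pq).
Qed.

Lemma chi_limsup_antitone (I J : finType) (x : I -> A) (y : J -> A) r M M' eps eps' :
  0 <= r -> (M <= M')%N -> eps' <= eps ->
  (chi_limsup phi x y r M' eps' <= chi_limsup phi x y r M eps)%E.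
Proof.
move=> r0 MM' ee'; apply: limn_esup_le => d; apply: leeD2r.
apply: lee_wpmul2l; first by rewrite lee_fin invr_ge0 sqr_ge0.
apply/le_lne/le_measure; rewrite ?inE; try exact: measurable_microstates_coord.
by move=> t; apply: microstates_antitone.
Qed.

Lemma chi_orb_limsup_antitone r M M' eps eps' :
  0 <= r -> (M <= M')%N -> eps' <= eps ->
  (chi_orb_limsup r M' eps' <= chi_orb_limsup r M eps)%E.
Proof.
move=> r0 MM' ee'; apply: limn_esup_le => d.
apply: lee_wpmul2l; first by rewrite lee_fin invr_ge0 sqr_ge0.
apply: ge_ereal_sup => _ [mu mu_reg <-].
apply: (@le_trans _ _ (chi_orb_fin_measure phi gamma X Y r M eps mu)); last first.
  by apply: ereal_sup_ubound; exists mu.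
apply/le_lne/le_measure; rewrite ?inE; try exact: measurable_orbital_preimage.
by move=> t; apply: microstates_antitone.
Qed.

Lemma chi_cutoff_le r : 0 <= r ->
  (chi_cutoff phi jX jY r <=
   chi_orb_cutoff phi gamma X Y r + \sum_(k < l) chi_cutoff phi (@X k) (@Y k) r)%E.
Proof.
move=> r0; pose D : set (nat * R) := [set p | 0 < p.2].
(* A later pair is a stricter condition: larger [M], smaller [eps]. Maximum and minimum make the
   pairs directed. *)
pose le (p q : nat * R) := (p.1 <= q.1)%N /\ q.2 <= p.2.
pose f (o : option 'I_l) (p : nat * R) := limn_esup (term r p.1 p.2 o).
have cutoffE (g : nat -> R -> \bar R) :
    [set z | exists (M : nat) (eps : R), 0 < eps /\ z = g M eps] =
    (fun p => g p.1 p.2) @` D.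
  apply/seteqP; split=> [z [M [eps [e0 ->]]]|_ [[M eps] /= e0 <-]].
    by exists (M, eps).
  by exists M, eps.
have D_directed s t : D s -> D t -> exists u, [/\ D u, le s u & le t u].
  move=> Ds Dt; exists (maxn s.1 t.1, Num.min s.2 t.2); rewrite /D /le /=.
  by rewrite lt_min leq_maxl leq_maxr !ge_min !lexx orbT; split=> //; apply/andP.
have D0 : D !=set0 by exists (0%N, 1); rewrite /D /=.
have f_antitone o : antitone D le (f o).
  move=> s t _ _ [st1 st2]; case: o => [k|].
    exact: chi_limsup_antitone.
  exact: chi_orb_limsup_antitone.
have f_lty o p : D p -> (f o p < +oo)%E.
  by move=> _; apply: le_lt_trans (ltry (Num.max 0 (bound r o)));
    apply: limn_esup_ub => d; exact: term_le.
have := ereal_inf_sum D_directed D0 options f_antitone f_lty.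
rewrite /options big_cons big_map /chi_cutoff /chi_orb_cutoff !cutoffE => h.
under eq_bigr do rewrite cutoffE.
apply: le_trans h; apply: le_ereal_inf_tmp => _ [p Dp <-].
rewrite big_cons big_map.
apply: le_trans (chi_limsup_le p.1 p.2 r0).
by apply: ereal_inf_lbound; exists p.
Qed.

End entropy_inequality.

Theorem theorem5p11 (R : realType) (A : cstar_algebra R) (phi : cstar_state A)
  (gamma : forall d : nat, probability (borel (unitary_group R d)) R)
  (gamma_haar : forall d : nat, haar_probability (gamma d))
  (l : nat) (l_gt0 : (0 < l)%N) (n m : 'I_l -> nat)
  (nm_ge1 : forall k : 'I_l, (1 <= n k + m k)%N)
  (X : forall k : 'I_l, 'I_(n k) -> A) (Y : forall k : 'I_l, 'I_(m k) -> A)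
  (XY_bipartite : tracially_bipartite phi (joint_family X) (joint_family Y)) :
  (chi phi (joint_family X) (joint_family Y) <=
     chi_orb phi gamma X Y + \sum_(k < l) chi phi (X k) (Y k))%E.
Proof.
(* The cutoff [r] is common to both sides; each summand on the right is then at most its own
   supremum. *)
apply: ge_ereal_sup => _ [r /= r0 <-].
apply: (le_trans (chi_cutoff_le phi gamma X Y (ltW r0))).
apply: leeD; first by apply: ereal_sup_ubound; exists r.
by apply: lee_sum => k _; apply: ereal_sup_ubound; exists r.
Qed.
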